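(* Let $p,q,r,s$ be primes such that $p \equiv q \equiv r \equiv 3 \pmod 4$, $qrs \equiv 1 \pmod 4$, and such that it is not the case that $\left(\frac{q}{s}\right) = \left(\frac{r}{s}\right) = 1$. Then the bi-quadratic field $\mathbb{Q}(\sqrt{2p}, \sqrt{qrs})$ is a Pólya field in the following cases. (i) $\left(\frac{q}{s}\right) = \left(\frac{r}{s}\right) = -1$ and at least one of the following conditions holds: C1: $\left(\frac{2p}{s}\right) = \left(\frac{qr}{p}\right) = -1$, $\left(\frac{2p}{q}\right) = 1$, and $q \not\equiv r \pmod 8$. C2: $\left(\frac{s}{p}\right) = 1$, $\left(\frac{qr}{p}\right) = -1$, $p \equiv q \equiv r \pmod 8$, and $s \equiv 5 \pmod 8$. C3: $\left(\frac{s}{p}\right) = \left(\frac{qr}{p}\right) = -1$, $p \not\equiv q \pmod 8$, $q \equiv r \pmod 8$, and $s \equiv 1 \pmod 8$. (ii) $\left(\frac{q}{s}\right) = -1$, $\left(\frac{r}{s}\right) = 1$, and at least one of the following conditions holds: C4: $\left(\frac{r}{p}\right) = \left(\frac{p}{q}\right) = \left(\frac{q}{r}\right) = -1$, and either [$\left(\frac{2}{p}\right) = \left(\frac{2}{r}\right) = \left(\frac{2}{s}\right) = -1$ and $\left(\frac{s}{p}\right) = 1$] or [$\left(\frac{2}{p}\right) = \left(\frac{2}{q}\right) = -\left(\frac{2}{r}\right) = \left(\frac{2}{s}\right) = 1$ and $\left(\frac{s}{p}\right) = -1$]. C5: $\left(\frac{r}{p}\right) = \left(\frac{p}{q}\right)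 = \left(\frac{r}{q}\right) = -1$, and either [$\left(\frac{2}{p}\right) = -\left(\frac{2}{r}\right) = -\left(\frac{2}{s}\right) = 1$ and $\left(\frac{s}{p}\right) = 1$] or [$\left(\frac{2}{p}\right) \neq \left(\frac{2}{q}\right)$, $\left(\frac{2}{r}\right) = -1$, $\left(\frac{2}{s}\right) = 1$ and $\left(\frac{s}{p}\right) = -1$]. C6: $\left(\frac{p}{r}\right) = \left(\frac{q}{p}\right) = \left(\frac{r}{q}\right) = -1$, and either [$\left(\frac{2}{p}\right) = \left(\frac{2}{r}\right) = -\left(\frac{2}{s}\right) = 1$ and $\left(\frac{s}{p}\right) = 1$] or [$\left(\frac{2}{p}\right) = \left(\frac{2}{q}\right) = -\left(\frac{2}{r}\right) = -\left(\frac{2}{s}\right) = -1$ and $\left(\frac{s}{p}\right) = -1$]. C7: $\left(\frac{p}{r}\right) = \left(\frac{q}{p}\right) = \left(\frac{q}{r}\right) = -1$, and either [$\left(\frac{2}{p}\right) = -\left(\frac{2}{r}\right) = \left(\frac{2}{s}\right) = -1$ and $\left(\frac{s}{p}\right) = 1$] or [$\left(\frac{2}{p}\right) \neq \left(\frac{2}{q}\right)$, $\left(\frac{2}{r}\right) = \left(\frac{2}{s}\right) = 1$ and $\left(\frac{s}{p}\right) = -1$].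
   Context: Here $\left(\frac{a}{\ell}\right)$ is the Legendre symbol for an odd prime $\ell$. For a number field $K$ with ring of integers $\mathcal{O}_K$, a prime number $\ell$ and an integer $f\ge 1$, the Ostrowski ideal $\Pi_{\ell^f}(K)$ is the product of all maximal ideals $\mathfrak{m}$ of $\mathcal{O}_K$ with norm $N_{K/\mathbb{Q}}(\mathfrak{m}) = \ell^f$ (equal to $\mathcal{O}_K$ if there are none). The Pólya group $Po(K)$ is the subgroup of the ideal class group of $K$ generated by the classes of all Ostrowski ideals of $K$. $K$ is a Pólya field if all its Ostrowski ideals are principal, equivalently if $Po(K)$ is trivial. *)

(* Defs.v *)
From HB Require Import structures.
From mathcomp Require Import all_boot all_order all_algebra all_field.
From mathcomp Require Import boolp classical_sets functions cardinality fsbigop.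

Set Implicit Arguments.
Unset Strict Implicit.
Unset Printing Implicit Defensive.

Import GRing.Theory.
Local Open Scope classical_set_scope.
Local Open Scope ring_scope.

Definition legendre (a : int) (l : nat) : int :=
  if (l%:Z %| a)%Z then 0
  else if [exists x : 'I_l, (x%:Z ^+ 2 == a %[mod l%:Z])%Z] then 1 else -1.

Section RingOfIntegers.
Variable K : fieldExtType rat.

Definition integer_pred : {pred K} :=
  fun x => `[< integralOver (intr : int -> K) x >].

Lemma integer_pred_subring : subring_closed integer_pred.
Proof.
split=> [|x y|x y].
- by rewrite unfold_in; apply/asboolP; exact: integral1.
- rewrite !unfold_in => /asboolP ix /asboolP iy; apply/asboolP.
  exact: integral_sub.
- rewrite !unfold_in => /asboolP ix /asboolP iy; apply/asboolP.
  exact: integral_mul.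
Qed.

HB.instance Definition _ :=
  GRing.isSubringClosed.Build K integer_pred integer_pred_subring.

Record ring_of_integers := IntegerOf {
  integer_val :> K;
  integer_valP : integer_val \in integer_pred
}.

HB.instance Definition _ := [isSub for integer_val].
HB.instance Definition _ := [Choice of ring_of_integers by <:].
HB.instance Definition _ :=
  [SubChoice_isSubComNzRing of ring_of_integers by <:].

End RingOfIntegers.

Section Ideals.
Variable R : comNzRingType.
Implicit Types I J m : set R.

(* [idealr_closed] is the library's notion of a proper ideal. *)
Definition maximal_ideal m : Prop :=
  idealr_closed [in m] /\ forall J, idealr_closed [in J] -> m `<=` J -> J = m.

Definition principal_ideal I : Prop := exists a : R, I = range ( *%R a).

Definition mul_ideal I J : set R :=
  [set x | exists n (u v : 'I_n -> R),
     [/\ forall i, I (u i), forall i, J (v i) & x = \sum_(i < n) u i * v i]].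

(* The norm of [I] is [n]: the quotient [R / I], here the set of cosets of
   [I], has exactly [n] elements. *)
Definition has_norm I (n : nat) : Prop :=
  (range (fun x : R => [set y | I (y - x)]) #= `I_n)%card.

End Ideals.

(* Only finitely many maximal ideals have a given norm, so that this finitely
   supported product ranges over all of them; [mul_ideal] is commutative and
   associative on ideals, with the unit ideal [setT] as neutral element. *)
Definition ostrowski_ideal (K : fieldExtType rat) (l f : nat) :
    set (ring_of_integers K) :=
  \big[@mul_ideal (ring_of_integers K)/setT]_(
    m \in [set m | maximal_ideal m /\ has_norm m (l ^ f)]) m.

Arguments ostrowski_ideal : clear implicits.

Definition polya_field (K : fieldExtType rat) : Prop :=
  forall l f : nat, prime l -> (0 < f)%N ->
    principal_ideal (ostrowski_ideal K l f).

(* Main.v *)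
From HB Require Import structures.
Require Import Defs.
From mathcomp Require Import all_boot all_order all_algebra all_field.
From mathcomp Require Import cyclic generic_quotient ring_quotient finmap.
From mathcomp Require Import boolp classical_sets functions cardinality fsbigop.
From mathcomp Require Import zify ring.

Set Implicit Arguments.
Unset Strict Implicit.
Unset Printing Implicit Defensive.

Import Order.TTheory GRing.Theory Num.Theory.
Local Open Scope ring_scope.

(** Put A = 2p and B = qrs, with square roots a and b in K.  The quadratic
    subfields of K have discriminants 4A, B and 4AB, so that the ramified
    primes are 2, p, q, r and s, all of ramification index 2.

    A prime l outside this list is unramified, and the product of the maximal
    ideals over l is (l).  If l is in the list, that product has square (l);
    it is principal as soon as (l) = (x)^2 for some integer x of K.  As K is
    Galois over the rationals all maximal ideals over l have the same norm,
    so every Ostrowski ideal attached to l is either that product or the unit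
    ideal.  Both facts are obtained from the Frobenius map x |-> x^l on the
    integers modulo l or modulo x ([prod_of_norm_principal],
    [ostrowski_principal]): it is determined by its values on a and on
    w = (1 + b)/2, because the integers of K are Z[a, w] ([integral_basis]), and
    it is an involution, whence the quotient is reduced and its residue fields
    have l or l^2 elements, uniformly.

    It remains to see that each of 2, p, q, r, s generates the square of a
    principal ideal.  Let S be the set of the n with this property.  It contains
    A and B, and with m and mn it contains n.  Other elements come from units.
    For D = A, B or AB, the fundamental solution of x^2 - D y^2 = 1 yields, by
    factoring (x - 1)(x + 1), a factorization D = d1 d2 with d1 <> 1 and
    d1 u^2 - d2 v^2 = 1 ([pell_descent]).  The square of d1 u + v sqrt D is then
    d1 times a unit, and d1 is in S.

    The equation d1 u^2 - d2 v^2 = 1 makes d1 a square modulo the odd primes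
    dividing d2, and - d2 a square modulo those dividing d1.  By quadratic
    reciprocity these are relations between the symbols of the statement
    ([descent_signs]).  As -1 is not a square modulo p, q, r, they give

    - for D = 2p, that d1 is 2 or p, so that 2 and p are in S;

    - for D = qrs, that d1 is s or qr in case (i), r or qs in case (ii);

    - for D = 2pqrs, that the part of d1 prime to 2p is not in the group
      generated by the previous d1 and by qrs, modulo squares.

    The classes of q, r and s modulo squares are generated by these two values
    and qrs, so that S contains q, r and s ([ambiguous_generators]). *)

(** * Quadratic residues and reciprocity *)

(** The multiplicative group of F is cyclic; if z generates it, then x = z ^+
    i has x ^+ #|F|./2 = 1 exactly when i is even. *)
Lemma euler_criterion (F : finFieldType) (x : F) : odd #|F| -> x != 0 ->
  x ^+ #|F|./2 = if [exists y, y ^+ 2 == x] then 1 else -1.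
Proof.
move=> oddF x0.
have cardF : #|F| = (#|F|./2.*2).+1 by rewrite -[LHS]odd_double_half oddF.
have h0 : (0 < #|F|./2)%N.
  by case: (#|F|./2) cardF (finNzRing_gt1 F) => // ->.
have unit_exp (y : F) : y != 0 -> y ^+ #|F|./2.*2 = 1.
  move=> y0; apply: (mulfI y0); rewrite mulr1 -exprS.
  by rewrite -cardF expf_card.
have xh_sq : (x ^+ #|F|./2) ^+ 2 = 1 by rewrite -exprM muln2 unit_exp.
have [/existsP[y /eqP yx]|nsq] := boolP [exists y, y ^+ 2 == x].
  rewrite -yx -exprM mul2n unit_exp //.
  by apply: contraNneq x0 => y0; rewrite -yx y0 expr0n.
have /eqP := xh_sq; rewrite sqrf_eq1 => /orP[/eqP xh|/eqP //].
have [||||z _ zprim] := hasP (@has_prim_root F #|F|./2.*2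
    (enum [pred y : F | y != 0]) _ _ _ _).
- by rewrite double_gt0.
- apply/allP=> y; rewrite mem_enum inE => y0.
  by rewrite unity_rootE unit_exp.
- exact: enum_uniq.
- rewrite -cardE; have -> : #|[pred y : F | y != 0]| = #|F|.-1.
    by rewrite -(cardC1 0); apply: eq_card.
  by rewrite [X in X.-1]cardF.
have [i xz] := prim_rootP zprim (unit_exp x x0).
have oi : odd i = false.
  case: i xz => i /= _ xz.
  move/eqP: xh; rewrite xz -exprM -(prim_order_dvd zprim).
  by rewrite -mul2n dvdn_pmul2r // dvdn2 => /negbTE.
case/negP: nsq; apply/existsP; exists (z ^+ i./2).
by rewrite xz -exprM muln2 -[X in _ == z ^+ X]odd_double_half oi.
Qed.

Lemma intr_Fp_eq (p : nat) (m n : int) : prime p ->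
  ((m%:~R : 'F_p) == n%:~R) = (m == n %[mod p%:Z])%Z.
Proof.
move=> pp; rewrite -subr_eq0 -intrB -(dvdz_pcharf (pchar_Fp pp)).
by rewrite eqz_mod_dvd.
Qed.

Lemma intr_Fp_eq0 (p : nat) (m : int) : prime p ->
  ((m%:~R : 'F_p) == 0) = (p%:Z %| m)%Z.
Proof. by move=> pp; rewrite -(dvdz_pcharf (pchar_Fp pp)). Qed.

Section Legendre.
Variable p : nat.
Hypotheses (p_prime : prime p) (p_odd : odd p).

Lemma legendre_Fp (a : int) :
  (legendre a p)%:~R = (a%:~R : 'F_p) ^+ p./2.
Proof.
have p2 : (1 < p./2.*2.+1)%N by rewrite odd_halfK //; case: p p_prime => // [] [].
have h0 : (0 < p./2)%N by rewrite -double_gt0.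
rewrite /legendre; case: ifPn => [pa|pa].
  by rewrite -(intr_Fp_eq0 a p_prime) in pa; rewrite (eqP pa) expr0n eqn0Ngt h0.
have a0 : (a%:~R : 'F_p) != 0 by rewrite intr_Fp_eq0.
have cF : #|'F_p| = p by rewrite card_Fp.
have := @euler_criterion 'F_p a%:~R; rewrite cF => -> //.
have -> : [exists x : 'I_p, (x%:Z ^+ 2 == a %[mod p%:Z])%Z]
   = [exists y : 'F_p, y ^+ 2 == a%:~R].
  apply/existsP/existsP => [[x xa]|[y ya]].
    by exists x%:R; rewrite -intr_Fp_eq // in xa; rewrite -(eqP xa) rmorphXn.
  have yp : (y < p)%N by rewrite -[X in (_ < X)%N]cF card_ord.
  exists (Ordinal yp); rewrite -intr_Fp_eq // rmorphXn /= -(eqP ya).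
  by rewrite -pmulrn natr_Zp.
by case: ifP.
Qed.

Lemma legendre_val (a : int) : legendre a p \in [:: 0; 1; -1].
Proof. by rewrite /legendre; case: ifP => // _; case: ifP. Qed.

Lemma legendre_eq0 (a : int) : (legendre a p == 0) = (p%:Z %| a)%Z.
Proof. by rewrite /legendre; case: ifP => // _; case: ifP. Qed.

End Legendre.

(** Values of symbols can be compared in any field of characteristic other
    than 2: this is how identities between integers are read off from F_p and
    from its algebraic closure. *)
Lemma sign_inj (F : fieldType) (x y : int) : 2%:R != 0 :> F ->
  x \in [:: 0; 1; -1] -> y \in [:: 0; 1; -1] -> x%:~R = y%:~R :> F -> x = y.
Proof.
move=> F2 hx hy /eqP; rewrite -subr_eq0 -intrB => /eqP xy.
have F1 := oner_neq0 F.
have F2' : - 2%:R != 0 :> F by rewrite oppr_eq0.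
have F1' : - 1 != 0 :> F by rewrite oppr_eq0.
move: hx hy xy; rewrite !inE.
by do 2!case/or3P=> /eqP->; move=> /eqP; rewrite ?(negPf F1) ?(negPf F2)
  ?(negPf F1') ?(negPf F2').
Qed.

Lemma Fp_two_neq0 (p : nat) : prime p -> odd p -> 2%:R != 0 :> 'F_p.
Proof.
move=> pp po; rewrite -(dvdn_pcharf (pchar_Fp pp)) dvdn_prime2 //.
by apply: contraTneq po => ->.
Qed.

Section LegendreTheory.
Variable p : nat.
Hypotheses (p_prime : prime p) (p_odd : odd p).

Let F2 := Fp_two_neq0 p_prime p_odd.

Lemma legendreM (a b : int) : legendre (a * b) p = legendre a p * legendre b p.
Proof.
apply: (sign_inj F2); first exact: legendre_val.
  by have := legendre_val p a; have := legendre_val p b; rewrite !inE;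
     do 2!case/or3P=> /eqP->.
by rewrite rmorphM /= !legendre_Fp // rmorphM exprMn.
Qed.

Lemma legendreN1 : legendre (-1) p = (-1) ^+ p./2.
Proof.
apply: (sign_inj F2); first exact: legendre_val.
  by rewrite -signr_odd; case: odd.
by rewrite !legendre_Fp // rmorphXn.
Qed.

Lemma eq_legendre (a b : int) : (a = b %[mod p%:Z])%Z ->
  legendre a p = legendre b p.
Proof.
move=> ab; apply: (sign_inj F2); rewrite ?legendre_val // !legendre_Fp //.
by congr (_ ^+ _); apply/eqP; rewrite intr_Fp_eq //; apply/eqP.
Qed.

Lemma legendre1 : legendre 1 p = 1.
Proof.
by apply: (sign_inj F2); rewrite ?legendre_val // legendre_Fp // expr1n.
Qed.

Lemma legendre_sqr (a : int) : ~~ (p%:Z %| a)%Z -> legendre (a ^+ 2) p = 1.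
Proof.
rewrite -legendre_eq0 expr2 legendreM => a0.
by have := legendre_val p a; rewrite !inE (negPf a0) /= => /orP[] /eqP ->.
Qed.

(** If every element were a square, then squaring would be injective on the
    finite set F_p, although it identifies 1 and -1. *)
Lemma nonresidue_exists : exists n : 'F_p, legendre n%:Z p = -1.
Proof.
have [/existsP[n /eqP]|] := boolP [exists n : 'F_p, legendre (n : nat)%:Z p == -1].
  by exists n.
rewrite negb_exists => /forallP nr.
have sq (y : 'F_p) : exists x : 'F_p, x ^+ 2 == y.
  have [->|y0] := eqVneq y 0; first by exists 0; rewrite expr0n.
  have := legendre_Fp p_prime p_odd y; rewrite -pmulrn natr_Zp.
  have := @euler_criterion 'F_p y; rewrite card_Fp // => -> //.
  case: existsP => [//|_] /eqP.
  have := legendre_val p y; rewrite !inE (negPf (nr y)) orbF.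
  case/orP=> /eqP->; last by rewrite -subr_eq0 opprK -mulr2n (negPf F2).
  by rewrite eq_sym oppr_eq0 oner_eq0.
have can_sq : cancel (fun y => xchoose (sq y)) (fun x : 'F_p => x ^+ 2).
  by move=> y; apply/eqP/(xchooseP (sq y)).
have inj_sq := can_inj (canF_sym can_sq).
have /eqP : 1 = -1 :> 'F_p by apply: inj_sq; rewrite sqrrN.
by rewrite -subr_eq0 opprK -mulr2n (negPf F2).
Qed.

End LegendreTheory.

(** Here e is a nontrivial additive character, an abstraction of a |-> z ^+ a
    for a root of unity z of order p. *)
Section GaussSum.

Variables (p : nat) (K : fieldType) (e : 'F_p -> K).
Hypotheses (p_prime : prime p) (p_odd : odd p).
Hypotheses (K2 : 2%:R != 0 :> K) (e0 : e 0 = 1).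
Hypotheses (eD : forall a b, e (a + b) = e a * e b) (sum_e : \sum_a e a = 0).

Let chi (a : 'F_p) : K := (legendre a%:Z p)%:~R.

Let chiE (a : int) : chi a%:~R = (legendre a p)%:~R.
Proof.
congr (_%:~R); apply: eq_legendre => //; apply/eqP.
by rewrite -intr_Fp_eq // -pmulrn natr_Zp.
Qed.

Let chiM a b : chi (a * b) = chi a * chi b.
Proof.
rewrite -[a in LHS]natr_Zp -[b in LHS]natr_Zp -natrM pmulrn chiE PoszM.
by rewrite legendreM // rmorphM.
Qed.

Let chi0 : chi 0 = 0.
Proof. by rewrite /chi /legendre dvdz0. Qed.

Let chi_sqr a : a != 0 -> chi a * chi a = 1.
Proof.
move=> a0; rewrite -chiM -expr2 -[a]natr_Zp pmulrn -rmorphXn chiE.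
by rewrite legendre_sqr // -intr_Fp_eq0 // -pmulrn natr_Zp.
Qed.

Let sum_chi : \sum_a chi a = 0.
Proof.
have [n chin] := nonresidue_exists p_prime p_odd.
have n0 : n != 0 by apply: contra_eqN chin => /eqP->; rewrite /legendre dvdz0.
apply: (mulfI K2); rewrite mulr0 mulr_natl mulr2n.
rewrite [X in X + _](reindex_inj (mulfI n0)) /= -big_split big1 //= => a _.
by rewrite chiM {1}/chi chin mulN1r addNr.
Qed.

Definition gauss_sum := \sum_a chi a * e a.

(** Substituting b = a c in the double sum over a and b turns the summand into
    chi c * e (a (1 + c)); summing over a first leaves only c = -1. *)
Lemma gauss_sum_sqr : gauss_sum ^+ 2 = (legendre (-1) p)%:~R * p%:R.
Proof.
have sum_e_mul b : \sum_a e (a * b) = (b == 0)%:R * p%:R.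
  have [->|b0] := eqVneq b 0.
    under eq_bigr => a _ do rewrite mulr0 e0.
    by rewrite sumr_const card_Fp // mul1r.
  by rewrite mul0r -[RHS]sum_e [RHS](reindex_inj (mulIf b0)).
rewrite expr2 /gauss_sum big_distrl /= (bigD1 0) //= chi0 !mul0r add0r.
transitivity (\sum_(a | a != 0) \sum_c chi c * e (a * (1 + c))).
  apply: eq_bigr => a a0; rewrite big_distrr /= (reindex_inj (mulfI a0)) /=.
  apply: eq_bigr => c _; rewrite chiM mulrDr mulr1 eD.
  by rewrite -[chi c in RHS]mul1r -(chi_sqr a0); ring.
(* The term a = 0 may be added, for it is the sum of chi, that is 0. *)
transitivity (\sum_a \sum_c chi c * e (a * (1 + c))).
  rewrite [RHS](bigD1 0) //=; under [X in _ = X + _]eq_bigr => c _.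
    by rewrite mul0r e0 mulr1; over.
  by rewrite sum_chi add0r.
rewrite exchange_big /=; under eq_bigr => c _ do rewrite -mulr_sumr sum_e_mul.
rewrite (bigD1 (-1)) //= subrr eqxx mul1r (chiE (-1)) big1 ?addr0 // => c c1.
by rewrite addrC addr_eq0 (negPf c1) mul0r mulr0.
Qed.

(** In characteristic q the q-th power of the sum has terms chi a * e (q a),
    and chi a = chi q * chi (q a). *)
Lemma gauss_sum_Frobenius q : q \in [pchar K] -> odd q -> ~~ (p %| q)%N ->
  gauss_sum ^+ q = (legendre q p)%:~R * gauss_sum.
Proof.
move=> qK qo pq; rewrite -(pFrobenius_autE qK) /gauss_sum rmorph_sum big_distrr /=.
have q0 : q%:R != 0 :> 'F_p by rewrite -(dvdn_pcharf (pchar_Fp p_prime)).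
rewrite [RHS](reindex_inj (mulfI q0)) /=; apply: eq_bigr => a _.
rewrite pFrobenius_autE exprMn.
have -> : chi a ^+ q = chi a.
  rewrite -[q]odd_double_half qo exprS -mul2n exprM expr2.
  have [->|/chi_sqr->] := eqVneq a 0; first by rewrite chi0 mul0r.
  by rewrite expr1n mulr1.
have -> : e a ^+ q = e (q%:R * a).
  elim: (q) => [|n IHn]; first by rewrite mul0r e0.
  by rewrite exprS IHn -eD; congr e; rewrite mulrS mulrDl mul1r.
rewrite chiM -(chiE q) -pmulrn !mulrA chi_sqr //.
by rewrite mul1r.
Qed.

End GaussSum.

(** A root z of 1 + X + ... + X ^+ p.-1 satisfies z ^+ p = 1, and its powers
    form the character. *)
Lemma Fp_additive_character (p : nat) (K : closedFieldType) : prime p ->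
  p%:R != 0 :> K -> exists e : 'F_p -> K,
  [/\ e 0 = 1, forall a b, e (a + b) = e a * e b & \sum_a e a = 0].
Proof.
move=> pp p0; have p1 := prime_gt1 pp.
have p1_gt0 : (0 < p.-1)%N by rewrite -ltnS (ltn_predK p1).
have [z zE] := solve_monicpoly (fun=> -1 : K) p1_gt0.
have sumz : \sum_(i < p) z ^+ i = 0.
  rewrite -(ltn_predK p1) big_ord_recr /= zE -big_split big1 //= => i _.
  by rewrite mulN1r addrN.
have zp : z ^+ p = 1 by apply/eqP; rewrite -subr_eq0 subrX1 sumz mulr0.
exists (fun a => z ^+ a); split=> // [a b|].
  have -> : nat_of_ord (a + b) = ((a + b)%N %% p)%N.
    exact: (f_equal (modn (a + b)%N) (Fp_cast pp)).
  by rewrite expr_mod // exprD.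
by rewrite -[RHS]sumz -!(big_mkord xpredT (fun i => z ^+ i)) Fp_cast.
Qed.

(** Computed in an algebraic closure of F_q, the q-th power of the Gauss sum G
    of p is legendre q p times G, and also the power q./2 of G ^+ 2 times G;
    as G ^+ 2 is plus or minus p, Euler's criterion modulo q compares the two. *)
Lemma quadratic_reciprocity (p q : nat) :
  prime p -> odd p -> prime q -> odd q -> p != q ->
  legendre (legendre (-1) p * p%:Z) q = legendre q p.
Proof.
move=> pp po pq qo npq.
have [K [f _]] := countable_algebraic_closure 'F_q.
have qK : q \in [pchar K] by rewrite (fmorph_pchar f) pchar_Fp.
have K2 : 2%:R != 0 :> K.
  by have := Fp_two_neq0 pq qo; rewrite -(fmorph_eq0 f) rmorph_nat.
have pK : p%:R != 0 :> K.
  by rewrite -(dvdn_pcharf qK) dvdn_prime2 // eq_sym.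
have [e [e0 eD sum_e]] := Fp_additive_character pp pK.
have sqrG := gauss_sum_sqr pp po K2 e0 eD sum_e.
have G0 : gauss_sum e != 0.
  rewrite -sqrf_eq0 sqrG mulf_neq0 //.
  by rewrite legendreN1 // rmorphXn signr_eq0.
have := gauss_sum_Frobenius pp po e0 eD qK qo.
rewrite dvdn_prime2 // => /(_ npq).
rewrite -[q in LHS]odd_double_half qo exprS -mul2n exprM sqrG mulrC.
move/(mulIf G0) => H; apply: (sign_inj K2); rewrite ?legendre_val //.
rewrite -H -[LHS](rmorph_int f) legendre_Fp // rmorphXn /= rmorph_int.
by rewrite rmorphM.
Qed.

(** If z ^+ 4 = -1 then t = z + z^-1 is a square root of 2, and t ^+ p = z ^+
    p + z ^- p depends only on p modulo 8. *)
Lemma legendre2 (p : nat) : prime p -> odd p ->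
  legendre 2 p = if (p %% 8 == 1)%N || (p %% 8 == 7)%N then 1 else -1.
Proof.
move=> pp po.
have [K [f _]] := countable_algebraic_closure 'F_p.
have pK : p \in [pchar K] by rewrite (fmorph_pchar f) pchar_Fp.
have K2 : 2%:R != 0 :> K.
  by have := Fp_two_neq0 pp po; rewrite -(fmorph_eq0 f) rmorph_nat.
have [z zE] := solve_monicpoly (fun i => if i is 0 then -1 else 0 : K) (isT : (0 < 4)%N).
have {}zE : z ^+ 4 = -1.
  by rewrite zE !big_ord_recl big_ord0 /= !mul0r !addr0 mulr1.
have z0 : z != 0.
  apply: contra_eqN zE => /eqP->; by rewrite expr0n eq_sym oppr_eq0 oner_eq0.
pose t := z + z^-1.
have t2 : t ^+ 2 = 2%:R.
  have -> : t ^+ 2 = 2%:R + (z ^+ 4 + 1) / z ^+ 2 by rewrite /t; field.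
  by rewrite zE addNr mul0r addr0.
have t0 : t != 0 by rewrite -sqrf_eq0 t2.
have tp : t ^+ p = z ^+ p + z ^- p.
  by rewrite -(pFrobenius_autE pK) rmorphD /= !pFrobenius_autE exprVn.
have z8 : z ^+ 8 = 1 by rewrite (exprM z 4 2) zE sqrrN expr1n.
have {}tp : t ^+ p = (if (p %% 8 == 1)%N || (p %% 8 == 7)%N then 1 else -1) * t.
  rewrite tp -(expr_mod p z8) /t.
  have : (p %% 8 < 8)%N by rewrite ltn_mod.
  have : odd (p %% 8) by rewrite odd_mod.
  have zV : z^-1 = - z ^+ 3 by apply: (mulfI z0); rewrite mulfV // mulrN -exprS zE opprK.
  rewrite -exprVn zV.
  case: (p %% 8)%N => [//|] [_ _|]; first by rewrite !expr1 mul1r.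
  case=> [//|] [_ _|].
    rewrite /= mulN1r; have -> : (- z ^+ 3) ^+ 3 = - (z ^+ 4) ^+ 2 * z by ring.
    by rewrite zE; ring.
  case=> [//|] [_ _|].
    rewrite /= mulN1r.
    have -> : (- z ^+ 3) ^+ 5 = - (z ^+ 4) ^+ 3 * z ^+ 3 by ring.
    by rewrite (exprD z 4 1) zE; ring.
  case=> [//|] [_ _|//].
  rewrite /= mul1r.
  have -> : (- z ^+ 3) ^+ 7 = - (z ^+ 4) ^+ 5 * z by ring.
  by rewrite (exprD z 4 3) zE; ring.
have : (legendre 2 p)%:~R * t = t ^+ p.
  rewrite -[p in RHS]odd_double_half po exprS -mul2n exprM t2 mulrC.
  congr (_ * _); rewrite -(rmorph_int f) legendre_Fp // rmorphXn /=.
  by rewrite rmorph_int.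
rewrite tp => /(mulIf t0) H.
apply: (sign_inj K2); rewrite ?legendre_val //; first by case: ifP.
by rewrite H; case: ifP.
Qed.

(** * The Pell equation and its descent *)

(** The indefinite forms a X^2 + 2 b X Y - c Y^2 with a, c > 0 of determinant
    b^2 + a c = D are those on the river of Conway's topograph of X^2 - D Y^2.
    There are finitely many of them, and walking along the river is
    reversible, so that the walk returns to X^2 - D Y^2; the substitution
    accumulated on the way is an automorph of that form, and its first column
    is a solution of the Pell equation. *)
Section River.
Variable D : nat.
Hypothesis D_nonsquare : forall n : nat, (n ^ 2)%N <> D.

(** The triple (a, b, c) stands for a X^2 + 2 b X Y - c Y^2. *)
Definition river_form (t : int * int * int) : Prop :=
  let: (a, b, c) := t in [/\ 0 < a, 0 < c & b ^+ 2 + a * c = D].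

(** The new value a + 2 b - c replaces a or c, according to its sign: the
    substitution is Y |-> X + Y or X |-> X + Y respectively. *)
Definition river_step (t : int * int * int) : int * int * int :=
  let: (a, b, c) := t in
  if 0 < a + 2 * b - c then (a + 2 * b - c, b - c, c)
  else (a, a + b, c - a - 2 * b).

Lemma river_step_form t : river_form t -> river_form (river_step t).
Proof.
case: t => [[a b] c] [/= a0 c0 eD].
case: ifP => [v0|/negbT]; first by split=> //; rewrite -eD; ring.
rewrite -leNgt => v0; have v1 : a + 2 * b - c != 0.
  (* A form representing 0 has a square determinant. *)
  apply/eqP => v; apply: (@D_nonsquare `|(a + b)%R|%N).
  have cE : c = a + 2 * b by lia.
  by apply/eqP; rewrite -eqz_nat -eD cE -abszX gez0_abs ?sqr_ge0 //; apply/eqP; ring.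
by split; [lia|lia|rewrite -eD; ring].
Qed.

(** A step that replaced a leaves a' - 2 b' - c' equal to the former a, which
    is positive; a step that replaced c leaves the opposite of the former c.
    So the kind of step can be recovered from its result. *)
Lemma river_step_inj t t' : river_form t -> river_form t' ->
  river_step t = river_step t' -> t = t'.
Proof.
case: t t' => [[a b] c] [[a' b'] c'] [a0 c0 _] [a0' c0' _] /=.
by case: ifP => ?; case: ifP => ? [] *; do 2?congr pair; lia.
Qed.

Let river n := iter n river_step (1, 0, D%:Z).

Lemma river_nth_form n : river_form (river n).
Proof.
elim: n => [|n IHn]; last exact: river_step_form.
split=> //; last by rewrite expr0n /= add0r mul1r.
by case: D D_nonsquare => // /(_ 0%N).
Qed.

(** All coordinates are bounded by D in absolute value, hence two positions
    coincide, and by injectivity of the steps the coincidence propagates back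
    to the start. *)
Lemma river_returns : exists2 n, (0 < n)%N & river n = (1, 0, D%:Z).
Proof.
pose code (t : int * int * int) : 'I_D.+1 * 'I_(D.*2.+1) * 'I_D.+1 :=
  let: (a, b, c) := t in (inord `|a|, inord `|b + D|, inord `|c|).
have codeI t t' : river_form t -> river_form t' -> code t = code t' -> t = t'.
  case: t t' => [[a b] c] [[a' b'] c'] [a0 c0 e] [a0' c0' e'] [].
  have bnd x y z : 0 < x -> 0 < z -> y ^+ 2 + x * z = D%:Z ->
    [/\ x <= D%:Z, z <= D%:Z, - D%:Z <= y & y <= D%:Z] by move=> *; split; nia.
  have [? ? ? ?] := bnd _ _ _ a0 c0 e; have [? ? ? ?] := bnd _ _ _ a0' c0' e'.
  move=> /(congr1 val) /= ea /(congr1 val) /= eb /(congr1 val) /= ec.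
  move: ea eb ec; rewrite !inordK; try lia.
  by move=> ? ? ?; do 2?congr pair; lia.
have [i [j [ltij eqij]]] : exists i j : nat, (i < j)%N /\ river i = river j.
  pose g (i : 'I_(#|{: 'I_D.+1 * 'I_(D.*2.+1) * 'I_D.+1}|).+1) := code (river i).
  have /injectivePn[i [j ij gij]] : ~~ injectiveb g.
    by apply/negP => /injectiveP /leq_card; rewrite card_ord ltnn.
  have {}gij : river i = river j by apply: codeI gij; exact: river_nth_form.
  move: ij; rewrite neq_ltn => /orP[lt|lt]; first by exists i, j.
  by exists j, i.
exists (j - i)%N; first by rewrite subn_gt0.
elim: i j ltij eqij => [|i IHi] [|j] //= ltij.
move/river_step_inj => /(_ (river_nth_form _) (river_nth_form _)).
by rewrite subSS; apply: IHi.
Qed.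

(** The n-th form is X^2 - D Y^2 in the basis (x, y), (x', y'). The second
    coordinate y stays 0 only as long as every step replaces c, and then a = 1
    and b increases by 1 at each step. *)
Lemma river_basis n : exists x y x' y' : nat, let: (a, b, c) := river n in
  [/\ x%:Z ^+ 2 - D%:Z * y%:Z ^+ 2 = a, x'%:Z ^+ 2 - D%:Z * y'%:Z ^+ 2 = - c,
      x%:Z * x'%:Z - D%:Z * y%:Z * y'%:Z = b, (0 < y')%N
    & (0 < y)%N \/ a = 1 /\ b = n].
Proof.
elim: n => [|n [x [y [x' [y' IHn]]]]].
  by exists 1%N, 0%N, 0%N, 1%N; split=> //=; [ring|ring|ring|right].
rewrite /river iterS -/(river n); case: (river n) IHn => [[a b] c] [Ea Ec Eb y'0 y0] /=.
case: ifP => [v0|/negbT v0].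
  exists (x + x')%N, (y + y')%N, x', y'; rewrite !PoszD; split=> //.
  - by rewrite -Ea -Eb -[c]opprK -Ec; ring.
  - by rewrite -Eb -[c]opprK -Ec; ring.
  - by left; rewrite addn_gt0 y'0 orbT.
exists x, y, (x + x')%N, (y + y')%N; rewrite !PoszD; split=> //.
- by rewrite -Ea -Eb -[c]opprK -Ec; ring.
- by rewrite -Ea -Eb; ring.
- by rewrite addn_gt0 y'0 orbT.
- by case: y0 => [|[-> ->]]; [left|right; split=> //; lia].
Qed.

Theorem pell : exists x y : nat, (0 < y)%N /\ (x ^ 2 = D * y ^ 2 + 1)%N.
Proof.
have [n n0 returns] := river_returns.
have [x [y [x' [y' ]]]] := river_basis n; rewrite returns => [[Ex _ _ _ y0]].
exists x, y; split; last by lia.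
by case: y0 => // [[_ n_eq]]; move: n0; lia.
Qed.
End River.

(** The square of gcd (a, y) is a times the gcd of a, y and b, since a b =
    y^2. *)
Lemma coprime_mul_square (a b y : nat) : coprime a b -> (a * b = y ^ 2)%N ->
  a = (gcdn a y ^ 2)%N.
Proof.
move=> cab aby; rewrite -mulnn muln_gcdl !muln_gcdr [(y * y)%N]mulnn -aby.
rewrite [(y * a)%N]mulnC -!muln_gcdr.
suff -> : gcdn (gcdn a y) (gcdn y b) = 1%N by rewrite muln1.
apply/eqP; rewrite -dvdn1 -(eqP cab) dvdn_gcd.
rewrite (dvdn_trans (dvdn_gcdl _ _)) ?dvdn_gcdl //.
by rewrite (dvdn_trans (dvdn_gcdr _ _)) ?dvdn_gcdr.
Qed.

Lemma sqr_mod4 (n : nat) : (n ^ 2 %% 4 = odd n)%N.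
Proof.
rewrite -{1}[n]odd_double_half -mul2n; case: odd => /=.
  by rewrite (_ : (_ ^ 2 = (n./2 ^ 2 + n./2) * 4 + 1)%N) ?modnMDl //; lia.
by rewrite add0n expnMn modnMr.
Qed.

(** Take the least y > 0 with x ^ 2 = D * y ^ 2 + 1. Modulo 4, x is odd and y
    is even, say x = 2 k + 1 and y = 2 z; then (k + 1) k = D z^2 with coprime
    factors, so k + 1 = d1 u^2 and k = d2 v^2 with d1 d2 = D. If d1 were 1,
    then (u, v) would be a smaller solution. *)
Lemma pell_descent (D : nat) : (forall n : nat, (n ^ 2)%N <> D) ->
  (D %% 4 = 1 \/ D %% 4 = 2)%N ->
  exists d1 d2 u v : nat,
    [/\ (d1 * d2 = D)%N, d1 <> 1%N & (d1 * u ^ 2 = d2 * v ^ 2 + 1)%N].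
Proof.
move=> Dns D4.
pose P y := (0 < y)%N && [exists x : 'I_(D * y ^ 2).+2, (x ^ 2 == D * y ^ 2 + 1)%N].
have exP : exists y, P y.
  have [x [y [y0 xy]]] := pell Dns; exists y; rewrite /P y0.
  have xlt : (x < (D * y ^ 2).+2)%N by nia.
  by apply/existsP; exists (Ordinal xlt); rewrite /= xy.
case: (ex_minnP exP) => y /andP[y0 /existsP[[x /= _] /eqP xy]] miny {exP}.
have [oy ox] : ~~ odd y /\ odd x.
  have := congr1 (modn^~ 4) xy; rewrite sqr_mod4 -modnDml -modnMm sqr_mod4.
  by case: D4 => ->; case: odd; case: odd.
pose z := y./2; pose k := x./2.
have yE : y = (2 * z)%N by rewrite mul2n even_halfK.
have xE : x = (2 * k + 1)%N by rewrite mul2n addn1 odd_halfK ?(prednK (odd_gt0 ox)).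
have z0 : (0 < z)%N by lia.
have kz : ((k + 1) * k = D * z ^ 2)%N by move: xy; rewrite xE yE; lia.
have cop : coprime (k + 1) k by rewrite addn1 coprimeSn.
pose d1 := gcdn (k + 1) D; pose d2 := gcdn k D.
have d12 : (d1 * d2 = D)%N.
  rewrite muln_gcdl !muln_gcdr kz [((k + 1) * D)%N]mulnC -!muln_gcdr.
  suff -> : gcdn (gcdn (z ^ 2) (k + 1)) (gcdn k D) = 1%N by rewrite muln1.
  apply/eqP; rewrite -dvdn1 -[X in (_ %| X)%N](eqP cop) dvdn_gcd.
  rewrite (dvdn_trans (dvdn_gcdl _ _)) ?dvdn_gcdr //.
  by rewrite (dvdn_trans (dvdn_gcdr _ _)) ?dvdn_gcdl.
have /dvdnP[A kA] : (d1 %| k + 1)%N by apply: dvdn_gcdl.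
have /dvdnP[B kB] : (d2 %| k)%N by apply: dvdn_gcdl.
have D0 : (0 < D)%N by case: (D) Dns => // /(_ 0%N).
have AB : (A * B = z ^ 2)%N.
  apply/eqP; rewrite -(eqn_pmul2l D0) -kz -[X in (X * _)%N == _]d12; apply/eqP.
  by transitivity ((A * d1) * (B * d2))%N; [ring | rewrite -kA -kB].
have copAB : coprime A B.
  by move: cop; rewrite kA kB coprimeMl !coprimeMr => /andP[/andP[]].
have [u Au] : exists u, A = (u ^ 2)%N.
  by exists (gcdn A z); apply: coprime_mul_square copAB AB.
have [v Bv] : exists v, B = (v ^ 2)%N.
  by exists (gcdn B z); apply: (@coprime_mul_square B A); rewrite 1?coprime_sym 1?mulnC.
have uv : z = (u * v)%N by apply/eqP; rewrite -eqn_sqr -AB Au Bv expnMn.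
exists d1, d2, u, v; split=> //; last by rewrite mulnC -Au -kA mulnC -Bv -kB.
have /andP[u0 v0] : (0 < u)%N && (0 < v)%N by rewrite -muln_gt0 -uv.
move=> d11; have Pv : P v.
  have uE : (u ^ 2 = D * v ^ 2 + 1)%N by rewrite -Au -[A]muln1 -d11 -kA kB Bv -d12 d11; ring.
  have ult : (u < (D * v ^ 2).+2)%N.
    rewrite ltnS -addn1 -uE; case: (u) => // n.
    by rewrite -mulnn leq_pmulr.
  by rewrite /P v0; apply/existsP; exists (Ordinal ult); rewrite /= uE.
have vz : (v <= z)%N by rewrite uv leq_pmull.
by have := miny _ Pv; lia.
Qed.

Lemma legendre_mul_sqr (a b : int) (l : nat) : prime l -> odd l ->
  (l%:Z %| a * b ^+ 2 - 1)%Z -> legendre a l = 1.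
Proof.
move=> lp lo ab1.
have H : legendre (a * b ^+ 2) l = 1.
  by rewrite -(legendre1 lp lo); apply: eq_legendre => //; apply/eqP; rewrite eqz_mod_dvd.
have lb : ~~ (l%:Z %| b)%Z.
  apply: contra_eqN H => lb; suff /eqP-> : legendre (a * b ^+ 2) l == 0 by [].
  by rewrite legendre_eq0 expr2 mulrA dvdz_mull.
by move: H; rewrite legendreM // legendre_sqr ?mulr1.
Qed.

Lemma legendre_descent_quot (d1 d2 u v l : nat) : prime l -> odd l ->
  (d1 * u ^ 2 = d2 * v ^ 2 + 1)%N -> (l %| d2)%N -> legendre d1 l = 1.
Proof.
move=> lp lo E ld2; apply: (@legendre_mul_sqr d1 u) => //.
have -> : d1%:Z * u%:Z ^+ 2 - 1 = (d2 * v ^ 2)%N by lia.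
exact: dvdn_mulr.
Qed.

Lemma legendre_descent_div (d1 d2 u v l : nat) : prime l -> odd l ->
  (d1 * u ^ 2 = d2 * v ^ 2 + 1)%N -> (l %| d1)%N -> legendre (- d2%:Z) l = 1.
Proof.
move=> lp lo E ld1; apply: (@legendre_mul_sqr _ v) => //.
have -> : - d2%:Z * v%:Z ^+ 2 - 1 = - (d1 * u ^ 2)%N%:Z by lia.
by rewrite dvdzE abszN; apply: dvdn_mulr.
Qed.

Lemma dvd_prime_prod (ls : seq nat) (l : nat) : prime l -> all prime ls ->
  (l %| \prod_(j <- ls) j)%N = (l \in ls).
Proof.
move=> lp; elim: ls => [|j ls IH] /=; first by rewrite big_nil dvdn1; case: l lp => [|[]].
by case/andP=> jp pls; rewrite big_cons Euclid_dvdM // dvdn_prime2 // inE IH.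
Qed.

(** For N > 0 this is equivalent to N having no repeated prime factor; it is
    the form in which that property is used below. *)
Definition squarefree (N : nat) : Prop :=
  forall x : int, (N%:Z %| x ^+ 2)%Z -> (N%:Z %| x)%Z.

Lemma squarefree_prod (ls : seq nat) : uniq ls -> all prime ls ->
  squarefree (\prod_(l <- ls) l)%N.
Proof.
move=> uls pls x; rewrite !dvdzE abszX.
elim: ls uls pls => [_ _|l ls IH /= /andP[lls uls] /andP[lp pls]]; first by rewrite big_nil !dvd1n.
have cop : coprime l (\prod_(j <- ls) j) by rewrite prime_coprime // dvd_prime_prod.
rewrite !big_cons !Gauss_dvd // => /andP[lx mx]; rewrite IH // andbT.
by move: lx; rewrite Euclid_dvdX // => /andP[].
Qed.

Lemma squarefree_nonsquare (D : nat) : squarefree D -> (1 < D)%N ->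
  forall n, (n ^ 2)%N <> D.
Proof.
move=> sqfD D1 n nD; have := sqfD n; rewrite !dvdzE abszX /= nD dvdnn => /(_ isT) Dn.
have n0 : (0 < n)%N by case: (n) nD D1 => // <-.
by have := dvdn_leq n0 Dn; move: D1; rewrite -nD -mulnn; nia.
Qed.

Lemma squarefree_divisors (ls : seq nat) (d1 d2 : nat) :
  uniq ls -> all prime ls -> (d1 * d2 = \prod_(l <- ls) l)%N ->
  d1 = (\prod_(l <- ls) l ^ (l %| d1))%N /\
  d2 = (\prod_(l <- ls) l ^ (~~ (l %| d1)))%N.
Proof.
elim: ls d1 d2 => [|l ls IH] d1 d2 /=.
  by move=> _ _; rewrite !big_nil => /eqP; rewrite muln_eq1 => /andP[/eqP-> /eqP->].
case/andP=> lls uls /andP[lp pls]; rewrite !big_cons => E.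
have l0 := prime_gt0 lp.
have [ld1|ld1] := boolP (l %| d1)%N.
  have /dvdnP[x xE] := ld1.
  have {}E : (x * d2 = \prod_(j <- ls) j)%N.
    by apply/eqP; rewrite -(eqn_pmul2l l0) -E xE; apply/eqP; ring.
  have [E1 E2] := IH _ _ uls pls E.
  have same j : j \in ls -> (j %| d1)%N = (j %| x)%N.
    move=> jls; rewrite xE (Euclid_dvdM _ _ (allP pls j jls)) (dvdn_prime2 (allP pls j jls) lp).
    by rewrite (_ : (j == l) = false) ?orbF //; apply: contraNF lls => /eqP<-.
  rewrite expn1 expn0 mul1n; split.
    rewrite {1}xE mulnC {1}E1; congr (_ * _)%N.
    by apply: eq_big_seq => j /same->.
  by rewrite {1}E2; apply: eq_big_seq => j /same->.
have ld2 : (l %| d2)%N.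
  by have := dvdn_mulr (\prod_(j <- ls) j) (dvdnn l); rewrite -E Euclid_dvdM // (negPf ld1).
have /dvdnP[x xE] := ld2.
have {}E : (d1 * x = \prod_(j <- ls) j)%N.
  by apply/eqP; rewrite -(eqn_pmul2l l0) -E xE; apply/eqP; ring.
have [E1 E2] := IH _ _ uls pls E.
by rewrite expn1 expn0 mul1n -E1 mulnC -E2 xE.
Qed.

(** The symbols as truth values, so that products of symbols become exclusive
    disjunctions. It is false when l divides a. *)
Definition nonresidue (a : int) (l : nat) : bool := legendre a l == -1.

Lemma nonresidue_self (l : nat) : nonresidue l l = false.
Proof. by rewrite /nonresidue /legendre dvdzz. Qed.

Lemma legendre_sign (a : int) (l : nat) : ~~ (l%:Z %| a)%Z ->
  legendre a l = (-1) ^+ nonresidue a l.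
Proof.
rewrite -legendre_eq0 /nonresidue => a0.
by have := legendre_val l a; rewrite !inE (negPf a0) /= => /orP[] /eqP->.
Qed.

Lemma legendre_prod (ls : seq nat) (e : nat -> bool) (l : nat) :
  prime l -> odd l -> all prime ls -> ~~ e l ->
  legendre (\prod_(j <- ls) j ^ e j)%N l =
    (-1) ^+ (\big[addb/false]_(j <- ls) (e j && nonresidue j l)).
Proof.
move=> lp lo; elim: ls => [|j ls IH] /=; first by rewrite !big_nil legendre1.
case/andP=> jp pls el; rewrite !big_cons PoszM legendreM // IH // signr_addb.
congr (_ * _); have [ej|_] := boolP (e j); last by rewrite expn0 legendre1.
rewrite expn1 legendre_sign // dvdzE /= dvdn_prime2 //.
by apply: contraNneq el => ->.
Qed.

Lemma sign_eq1 (b : bool) : (-1) ^+ b = 1 :> int -> b = false.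
Proof. by case: b. Qed.

(** The relation at l expresses that d1 is a square modulo l if l divides d2,
    and that - d2 is one if l divides d1; here e is the set of the primes
    dividing d1. The summands with e j != e l are the primes in the factor
    that is prime to l, which is d1 in the first case and d2 in the second. *)
Lemma descent_signs (ls : seq nat) : let D := (\prod_(l <- ls) l)%N in
  uniq ls -> all prime ls -> ls != [::] -> (D %% 4 = 1 \/ D %% 4 = 2)%N ->
  exists (e : nat -> bool) (u v : nat),
  [/\ has e ls,
      ((\prod_(l <- ls) l ^ e l) * u ^ 2 = (\prod_(l <- ls) l ^ (~~ e l)) * v ^ 2 + 1)%N
    & {in ls, forall l, odd l -> e l && nonresidue (-1) l =
       \big[addb/false]_(j <- ls) ((e j (+) e l) && nonresidue j l)}].
Proof.
move=> D uls pls ls0 D4.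
have sqfD : squarefree D by apply: squarefree_prod.
have D1 : (1 < D)%N.
  move: ls0 pls; rewrite /D; case: (ls) => // l ls' _ /= /andP[lp pls'].
  rewrite big_cons (leq_trans (prime_gt1 lp)) // leq_pmulr // big_seq.
  by apply: prodn_cond_gt0 => j /(allP pls')/prime_gt0.
have Dns := squarefree_nonsquare sqfD D1.
have [d1 [d2 [u [v [d12 d1n1 E]]]]] := pell_descent Dns D4.
have [E1 E2] := squarefree_divisors uls pls d12.
exists (fun l => l %| d1)%N, u, v; split; rewrite -?E1 -?E2 //.
  apply/negPn/negP => /hasPn nod; case: d1n1; rewrite E1 big1_seq // => l /= lls.
  by rewrite (negPf (nod l lls)).
move=> l lls lo; have lp := allP pls l lls.
have [ld1|ld1] /= := boolP (l %| d1)%N.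
  have := legendre_descent_div lp lo E ld1.
  rewrite -[- d2%:Z]mulN1r legendreM // legendre_sign; last first.
    by rewrite dvdzE dvdn1; case: (l) lp => [|[]].
  rewrite {1}E2 legendre_prod ?negbK // -signr_addb => /sign_eq1 /addbP H.
  have -> : \big[addb/false]_(j <- ls) (((j %| d1)%N (+) true) && nonresidue j l) =
     \big[addb/false]_(j <- ls) ((~~ (j %| d1)%N) && nonresidue j l).
    by apply: eq_bigr => j _; rewrite addbT.
  by move: H; case: nonresidue; case: (\big[_/_]_(_ <- _) _).
have ld2 : (l %| d2)%N.
  have : (l %| d1 * d2)%N by rewrite d12 dvd_prime_prod.
  by rewrite Euclid_dvdM // (negPf ld1).
have := legendre_descent_quot lp lo E ld2.
rewrite {1}E1 legendre_prod // => /sign_eq1 H; rewrite -[LHS]H.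
by apply: eq_bigr => j _; rewrite addbF.
Qed.

(** * The residue symbols of p, q, r, s *)

Lemma nonresidue1 (a : int) (l : nat) : legendre a l = 1 -> nonresidue a l = false.
Proof. by rewrite /nonresidue => ->. Qed.

Lemma nonresidueN1 (a : int) (l : nat) : legendre a l = -1 -> nonresidue a l.
Proof. by rewrite /nonresidue => ->. Qed.

Lemma nonresidueM (a b : int) (l : nat) : prime l -> odd l ->
  legendre (a * b) l != 0 -> nonresidue (a * b) l = nonresidue a l (+) nonresidue b l.
Proof.
move=> lp lo; rewrite [nonresidue (a * b) l]/nonresidue legendreM // mulf_eq0 negb_or.
rewrite !legendre_eq0 => /andP[/legendre_sign-> /legendre_sign->].
by case: nonresidue; case: nonresidue.
Qed.

Lemma odd_mod4_1 (l : nat) : (l %% 4 = 1)%N -> odd l. Proof. by lia. Qed.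
Lemma odd_mod4_3 (l : nat) : (l %% 4 = 3)%N -> odd l. Proof. by lia. Qed.

Lemma nonresidue_m1_mod4_3 (l : nat) : prime l -> (l %% 4 = 3)%N -> nonresidue (-1) l.
Proof.
move=> lp l4; apply: nonresidueN1; rewrite legendreN1 ?odd_mod4_3 //.
by rewrite -signr_odd (_ : odd l./2 = true) //; lia.
Qed.

Lemma legendre_m1_mod4_1 (l : nat) : prime l -> (l %% 4 = 1)%N -> legendre (-1) l = 1.
Proof.
move=> lp l4; rewrite legendreN1 ?odd_mod4_1 //.
by rewrite -signr_odd (_ : odd l./2 = false) //; lia.
Qed.

Lemma prime_ndvd (p q : nat) : prime p -> prime q -> p != q -> ~~ (q%:Z %| p%:Z)%Z.
Proof. by move=> pp qp pq; rewrite dvdzE /= dvdn_prime2 // eq_sym. Qed.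

Lemma reciprocity_mod4_3 (p q : nat) : prime p -> prime q -> p != q ->
  (p %% 4 = 3)%N -> (q %% 4 = 3)%N -> nonresidue q p = ~~ nonresidue p q.
Proof.
move=> pp qp npq p4 q4; have [po qo] := (odd_mod4_3 p4, odd_mod4_3 q4).
have := quadratic_reciprocity pp po qp qo npq.
have /eqP-> := nonresidue_m1_mod4_3 pp p4.
rewrite legendreM // (eqP (nonresidue_m1_mod4_3 qp q4)) [nonresidue q p]/nonresidue => <-.
rewrite legendre_sign ?prime_ndvd //.
by case: nonresidue.
Qed.

Lemma reciprocity_mod4_1 (s q : nat) : prime s -> prime q -> s != q ->
  (s %% 4 = 1)%N -> odd q -> nonresidue q s = nonresidue s q.
Proof.
move=> sp qp nsq s4 qo; have so := odd_mod4_1 s4.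
have := quadratic_reciprocity sp so qp qo nsq.
by rewrite legendre_m1_mod4_1 // mul1r /nonresidue => ->.
Qed.

Lemma nonresidue2_mod4_3 (l : nat) : prime l -> (l %% 4 = 3)%N ->
  nonresidue 2 l = (l %% 8 == 3)%N.
Proof.
move=> lp l4; rewrite /nonresidue legendre2 ?odd_mod4_3 //.
have [->|->] : (l %% 8 = 3)%N \/ (l %% 8 = 7)%N by lia.
  by [].
by [].
Qed.

Lemma nonresidue2_mod4_1 (l : nat) : prime l -> (l %% 4 = 1)%N ->
  nonresidue 2 l = (l %% 8 == 5)%N.
Proof.
move=> lp l4; rewrite /nonresidue legendre2 ?odd_mod4_1 //.
have [->|->] : (l %% 8 = 1)%N \/ (l %% 8 = 5)%N by lia.
  by [].
by [].
Qed.

(** The booleans tp, tq, tr, ts stand for nonresidue 2 p, ..., nonresidue 2 s,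
    and pq, pr, qr, ps, qs, rs for nonresidue p q, nonresidue p r,
    nonresidue q r, nonresidue s p, nonresidue s q, nonresidue s r. By
    reciprocity these ten values determine all the others: nonresidue q p is
    ~~ pq, since p and q are 3 modulo 4, and nonresidue p s is ps, since s is 1
    modulo 4. *)
Section SymbolPatterns.
Variables tp tq tr ts pq pr qr ps qs rs : bool.

(** The relations of [descent_signs] for D = qrs, at q, r and s in this order;
    eq, er, es tell which primes divide d1. *)
Definition pell_signs_qrs (eq er es : bool) := 
  [&& eq == ((er (+) eq) && ~~ qr) (+) ((es (+) eq) && qs),
      er == ((eq (+) er) && qr) (+) ((es (+) er) && rs) &
      false == ((eq (+) es) && qs) (+) ((er (+) es) && rs)].

(** The same relations for D = 2pqrs, at p, q, r and s. *)
Definition pell_signs_2pqrs (e2 ep eq er es : bool) :=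
  [&& ep == ((e2 (+) ep) && tp) (+) ((eq (+) ep) && ~~ pq) (+) ((er (+) ep) && ~~ pr)
         (+) ((es (+) ep) && ps),
      eq == ((e2 (+) eq) && tq) (+) ((ep (+) eq) && pq) (+) ((er (+) eq) && ~~ qr)
         (+) ((es (+) eq) && qs),
      er == ((e2 (+) er) && tr) (+) ((ep (+) er) && pr) (+) ((eq (+) er) && qr)
         (+) ((es (+) er) && rs) &
      false == ((e2 (+) es) && ts) (+) ((ep (+) es) && ps) (+) ((eq (+) es) && qs)
         (+) ((er (+) es) && rs)].

(** Case (i) of the theorem, with the alternatives C1, C2, C3. *)
Definition symbols_i :=
 [&& qs, rs &
  [|| [&& ts (+) ps, (~~ pq) (+) (~~ pr), ~~ (tq (+) pq) & tq != tr],
   [&& ~~ ps, (~~ pq) (+) (~~ pr), tp == tq, tq == tr & ts] |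
   [&& ps, (~~ pq) (+) (~~ pr), tp != tq, tq == tr & ~~ ts]]].

(** Case (ii) of the theorem, with the alternatives C4, C5, C6, C7. *)
Definition symbols_ii :=
 [&& qs, ~~ rs &
  [|| [&& ~~ pr, pq, qr &
        [&& tp, tr, ts & ~~ ps] || [&& ~~ tp, ~~ tq, tr, ~~ ts & ps]],
      [&& ~~ pr, pq, ~~ qr &
        [&& ~~ tp, tr, ts & ~~ ps] || [&& tp != tq, tr, ~~ ts & ps]],
      [&& pr, ~~ pq, ~~ qr &
        [&& ~~ tp, ~~ tr, ts & ~~ ps] || [&& tp, tq, ~~ tr, ~~ ts & ps]] |
      [&& pr, ~~ pq, qr &
        [&& tp, ~~ tr, ts & ~~ ps] || [&& tp != tq, ~~ tr, ~~ ts & ps]]]].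

(** In case (i) neither q, r nor their opposites are squares modulo s: only s
    and qr remain for d1. *)
Lemma pell_signs_qrs_i eq er es : symbols_i -> pell_signs_qrs eq er es -> [|| eq, er | es] ->
  (eq == er) && (er != es).
Proof. by rewrite /symbols_i /pell_signs_qrs; case: qs rs qr eq er es => [] [] // [] [] [] []. Qed.

(** In case (ii) only r and qs remain. *)
Lemma pell_signs_qrs_ii eq er es : symbols_ii -> pell_signs_qrs eq er es -> [|| eq, er | es] ->
  (eq == es) && (er != es).
Proof. by rewrite /symbols_ii /pell_signs_qrs; case: qs rs qr eq er es => [] [] // [] [] [] []. Qed.

(** Modulo squares, qrs and the d1 of [pell_signs_qrs_i] generate 1, s, qr and
    qrs; a divisor of 2pqrs has its part prime to 2p outside this group when
    exactly one of q and r divides it. *)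
Lemma pell_signs_2pqrs_i e2 ep eq er es : symbols_i -> pell_signs_2pqrs e2 ep eq er es ->
  [|| e2, ep, eq, er | es] -> eq != er.
Proof.
rewrite /symbols_i /pell_signs_2pqrs; case: qs rs => [] [] //=.
case: pq pr ps ts tp tq tr => [] [] //= [] [] //= [] [] //= [] //=;
by case: qr e2 ep eq er es => [] [] [] [] [] [].
Qed.

(** The group is now 1, r, qs, qrs, and the divisors outside it are those
    divisible by exactly one of q and s. *)
Lemma pell_signs_2pqrs_ii e2 ep eq er es : symbols_ii -> pell_signs_2pqrs e2 ep eq er es ->
  [|| e2, ep, eq, er | es] -> eq != es.
Proof.
rewrite /symbols_ii /pell_signs_2pqrs; case: qs rs => [] [] //=.
case: pq pr qr => [] [] [] //=; case: ps ts tr tp tq => [] [] [] //= [] //= [] //=;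
by case: e2 ep eq er es => [] [] [] [] [].
Qed.
End SymbolPatterns.

(** The predicate P abstracts the property of generating the square of a
    principal ideal of K: what matters is its stability under division and that
    it holds of 2p, of qrs and of the d1 provided by the Pell equations. *)
Section AmbiguousGenerators.
Variables p q r s : nat.
Hypotheses (p_prime : prime p) (q_prime : prime q) (r_prime : prime r).
Hypotheses (s_prime : prime s).
Hypotheses (p4 : (p %% 4 = 3)%N) (q4 : (q %% 4 = 3)%N) (r4 : (r %% 4 = 3)%N).
Hypotheses (s4 : (s %% 4 = 1)%N).
Hypotheses (pNq : p != q) (pNr : p != r) (qNr : q != r).

Let symbols_i_pqrs := symbols_i (nonresidue 2 p) (nonresidue 2 q) (nonresidue 2 r)
  (nonresidue 2 s) (nonresidue p q) (nonresidue p r)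
  (nonresidue s p) (nonresidue s q) (nonresidue s r).
Let symbols_ii_pqrs := symbols_ii (nonresidue 2 p) (nonresidue 2 q) (nonresidue 2 r)
  (nonresidue 2 s) (nonresidue p q) (nonresidue p r) (nonresidue q r)
  (nonresidue s p) (nonresidue s q) (nonresidue s r).

Variable P : nat -> Prop.
Hypothesis P_cancel : forall m n, (0 < m)%N -> P m -> P (m * n)%N -> P n.
Hypothesis P_solution : forall d1 d2 u v, 
  (d1 * d2 = 2 * p \/ d1 * d2 = q * r * s \/ d1 * d2 = 2 * p * (q * r * s))%N ->
  (d1 * u ^ 2 = d2 * v ^ 2 + 1)%N -> P d1.
Hypotheses (P_2p : P (2 * p)%N) (P_qrs : P (q * r * s)%N).

Let po := odd_mod4_3 p4.
Let qo := odd_mod4_3 q4.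
Let ro := odd_mod4_3 r4.
Let so := odd_mod4_1 s4.
Let sNp : s != p. Proof. by apply/eqP => E; move: s4; rewrite E p4. Qed.
Let sNq : s != q. Proof. by apply/eqP => E; move: s4; rewrite E q4. Qed.
Let sNr : s != r. Proof. by apply/eqP => E; move: s4; rewrite E r4. Qed.

Let prod_compl (ls : seq nat) (e : nat -> bool) :
  ((\prod_(l <- ls) l ^ e l) * \prod_(l <- ls) l ^ (~~ e l) = \prod_(l <- ls) l)%N.
Proof.
by rewrite -big_split; apply: eq_bigr => l _; case: (e l); rewrite /= ?mul1n ?muln1 expn1.
Qed.

Let rec := (reciprocity_mod4_3 p_prime q_prime pNq p4 q4,
            reciprocity_mod4_3 p_prime r_prime pNr p4 r4,
            reciprocity_mod4_3 q_prime r_prime qNr q4 r4,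
            reciprocity_mod4_1 s_prime p_prime sNp s4 po,
            reciprocity_mod4_1 s_prime q_prime sNq s4 qo,
            reciprocity_mod4_1 s_prime r_prime sNr s4 ro,
            (nonresidue_m1_mod4_3 p_prime p4, nonresidue_m1_mod4_3 q_prime q4,
            nonresidue_m1_mod4_3 r_prime r4,
            nonresidue1 (legendre_m1_mod4_1 s_prime s4)),
            nonresidue_self).

Let P_2_p : P 2 /\ P p.
Proof.
have [||||e [u [v [he E H]]]] := @descent_signs [:: 2; p]%N.
- by rewrite /= inE andbT; apply: contraTneq po => <-.
- by rewrite /= p_prime.
- by [].
- by rewrite big_cons big_seq1; right; lia.
have := H p; rewrite !inE eqxx orbT => /(_ isT po).
rewrite big_cons big_seq1 !rec !(andbT, andbF, addbF) => ep.
have := @P_solution _ _ u v (or_introl _ _) E.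
rewrite prod_compl !(big_cons, big_nil) muln1 => /(_ erefl) {E}.
move: he; rewrite /= orbF; move: ep.
case: (e 2) => /=; case: (e p) => //= _ _; rewrite expn1 expn0 ?muln1 ?mul1n => Pd.
  by split=> //; apply: P_cancel Pd P_2p.
by split=> //; apply: P_cancel (prime_gt0 p_prime) Pd _; rewrite mulnC.
Qed.

Let qrs_mod4 : (q * r * s %% 4 = 1)%N.
Proof. by rewrite -modnMm -(modnMm q) q4 r4 s4. Qed.

Let D2_solution : exists eq er es : bool,
  [/\ pell_signs_qrs (nonresidue q r) (nonresidue s q) (nonresidue s r) eq er es,
     [|| eq, er | es] & P (q ^ eq * r ^ er * s ^ es)%N].
Proof.
have [||||e [u [v [he E H]]]] := @descent_signs [:: q; r; s]%N.
- by rewrite /= !inE andbT negb_or qNr [q == s]eq_sym sNq eq_sym sNr.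
- by rewrite /= q_prime r_prime s_prime.
- by [].
- by left; rewrite !(big_cons, big_nil) muln1 mulnA.
exists (e q), (e r), (e s); split; last first.
- have := @P_solution _ _ u v (or_intror _ (or_introl _ _)) E.
  by rewrite prod_compl !(big_cons, big_nil) !muln1 !mulnA; apply.
- by rewrite -[e s]orbF; exact: he.
have Hq := H q; have Hr := H r; have := H s; move: Hq Hr.
rewrite !inE !eqxx !orbT /= => /(_ isT qo) + /(_ isT ro) + /(_ isT so).
rewrite /pell_signs_qrs !(big_cons, big_nil) !rec !(andbT, andbF, addbF, addFb).
by move=> /eqP-> /eqP-> /eqP->.
Qed.

Let D3_solution : exists e2 ep eq er es : bool,
  [/\ pell_signs_2pqrs (nonresidue 2 p) (nonresidue 2 q) (nonresidue 2 r)
  (nonresidue 2 s) (nonresidue p q) (nonresidue p r) (nonresidue q r)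
  (nonresidue s p) (nonresidue s q) (nonresidue s r) e2 ep eq er es,
     [|| e2, ep, eq, er | es] & P (2 ^ e2 * (p ^ ep * (q ^ eq * r ^ er * s ^ es)))%N].
Proof.
have [||||e [u [v [he E H]]]] := @descent_signs [:: 2; p; q; r; s]%N.
- have odd2 l : odd l -> (2 == l)%N = false by case: l => [|[|[]]].
  by rewrite /= !inE !negb_or !odd2 // pNq pNr qNr !(eq_sym _ s) sNp sNq sNr.
- by rewrite /= p_prime q_prime r_prime s_prime.
- by [].
- right; rewrite !(big_cons, big_nil) muln1.
  rewrite [(q * _)%N]mulnA mulnA -modnMm qrs_mod4 muln1 modn_mod; lia.
exists (e 2), (e p), (e q), (e r), (e s); split; last first.
- have := @P_solution _ _ u v (or_intror _ (or_intror _ _)) E.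
  by rewrite prod_compl !(big_cons, big_nil) !muln1 !mulnA; apply.
- by rewrite -[e s]orbF; exact: he.
have Hp := H p; have Hq := H q; have Hr := H r; have := H s; move: Hp Hq Hr.
rewrite !inE !eqxx !orbT /= => /(_ isT po) + /(_ isT qo) + /(_ isT ro) + /(_ isT so).
rewrite /pell_signs_2pqrs !(big_cons, big_nil) !rec !(andbT, andbF, addbF, addFb) !addbA.
by move=> /eqP-> /eqP-> /eqP-> /eqP->.
Qed.

(** Dividing the d1 of D = 2pqrs by 2, p and s leaves q or r in case (i),
    where qr is known to satisfy P; dividing it by 2, p and r leaves q or s in
    case (ii), where qs is known. *)
Lemma ambiguous_generators : symbols_i_pqrs || symbols_ii_pqrs ->
  [/\ P 2, P p, P q, P r & P s].
Proof.
have [P2 Pp] := P_2_p.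
have [[q0 r0] s0] := (prime_gt0 q_prime, prime_gt0 r_prime, prime_gt0 s_prime).
have P_power l (e : bool) n : (0 < l)%N -> P l -> P (l ^ e * n)%N -> P n.
  by case: e => l0 Pl; rewrite /= ?mul1n // expn1; apply: P_cancel.
have [e2 [ep [fq [fr [fs [pell_signs_qrs' nz3]]]]]] := D3_solution.
move/(P_power 2%N e2 _ isT P2)/(P_power p ep _ (prime_gt0 p_prime) Pp) => Pf.
have [eq [er [es [sol2' nz2 Pe]]]] := D2_solution.
move=> c12; suff [Pq Pr Ps] : [/\ P q, P r & P s] by split.
case/orP: c12 => [c1|c2].
  have := pell_signs_qrs_i c1 sol2' nz2; have := pell_signs_2pqrs_i c1 pell_signs_qrs' nz3.
  have [Pqr Ps] : P (q * r)%N /\ P s.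
    have := pell_signs_qrs_i c1 sol2' nz2; move: Pe.
    case: eq {sol2' nz2} => [|]; case: er => //; case: es => //=;
      rewrite !(expn0, expn1, mul1n, muln1) => Pqr _.
      by split=> //; apply: P_cancel Pqr P_qrs; rewrite muln_gt0 q0.
    by split=> //; apply: (@P_cancel s) => //; rewrite mulnC.
  move: Pf; rewrite mulnC => /(P_power _ _ _ s0 Ps); case: fq {pell_signs_qrs' nz3}; case: fr => //=;
    rewrite !(expn0, expn1, mul1n, muln1) => Pl _ _.
    by split=> //; apply: P_cancel Pl Pqr.
  by split=> //; apply: (@P_cancel r) => //; rewrite mulnC.
have := pell_signs_2pqrs_ii c2 pell_signs_qrs' nz3.
have [Pqs Pr] : P (q * s)%N /\ P r.
  have := pell_signs_qrs_ii c2 sol2' nz2; move: Pe.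
  case: eq {sol2' nz2} => [|]; case: er => //; case: es => //=;
    rewrite !(expn0, expn1, mul1n, muln1) => Pl _.
    by split=> //; apply: (@P_cancel (q * s)%N); rewrite 1?mulnAC // muln_gt0 q0.
  by split=> //; apply: (@P_cancel r) => //; rewrite mulnC mulnAC.
move: Pf; rewrite [(q ^ _ * _)%N]mulnC -mulnA => /(P_power _ _ _ r0 Pr).
case: fq {pell_signs_qrs' nz3}; case: fs => //=;
  rewrite !(expn0, expn1, mul1n, muln1) => Pl _.
  by split=> //; apply: P_cancel Pl Pqs.
by split=> //; apply: (@P_cancel s) => //; rewrite mulnC.
Qed.
End AmbiguousGenerators.

(** * Maximal ideals and their norms *)

Section IdealTheory.
Local Open Scope classical_set_scope.
Variable R : comNzRingType.
Implicit Types (I J m : set R) (x y : R).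

(** Unlike [idealr_closed], this allows the unit ideal. *)
Definition is_ideal I : Prop :=
  I 0 /\ forall a u v, I u -> I v -> I (a * u + v).

Lemma idealr_closedP I : idealr_closed [in I] <-> is_ideal I /\ ~ I 1.
Proof.
split=> [[I0 I1 IL]|[[I0 IL] I1]].
  split; last by move=> /mem_set; apply/negP.
  split=> [|a u v /mem_set uI /mem_set vI]; apply/set_mem; first exact: I0.
  exact: IL.
split; first exact/mem_set; first by apply/negP => /set_mem.
by move=> a u v /set_mem uI /set_mem vI; apply/mem_set/IL.
Qed.

Section Ideal.
Variable I : set R.
Hypothesis idI : is_ideal I.

Lemma ideal0 : I 0. Proof. by case: idI. Qed.
Lemma ideal_mull a u : I u -> I (a * u).
Proof. by move=> uI; rewrite -[a * u]addr0; apply: idI.2 => //; apply: ideal0. Qed.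
Lemma ideal_mulr a u : I u -> I (u * a).
Proof. by rewrite mulrC; apply: ideal_mull. Qed.
Lemma idealD u v : I u -> I v -> I (u + v).
Proof. by move=> uI vI; rewrite -[u]mul1r; apply: idI.2. Qed.
Lemma idealN u : I u -> I (- u).
Proof. by move=> uI; rewrite -mulN1r; apply: ideal_mull. Qed.
Lemma idealB u v : I u -> I v -> I (u - v).
Proof. by move=> uI vI; apply: idealD => //; apply: idealN. Qed.
Lemma ideal_sum (T : Type) (s : seq T) (P : pred T) (F : T -> R) :
  (forall i, P i -> I (F i)) -> I (\sum_(i <- s | P i) F i).
Proof. by move=> FI; elim/big_ind: _ => //; [apply: ideal0 | apply: idealD]. Qed.
End Ideal.

Lemma maximal_ideal_proper m : maximal_ideal m -> is_ideal m /\ ~ m 1.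
Proof. by case=> /idealr_closedP. Qed.

Lemma principal_is_ideal (a : R) : is_ideal (range ( *%R a)).
Proof.
split; first by exists 0; rewrite ?mulr0.
by move=> b _ _ [u _ <-] [v _ <-]; exists (b * u + v) => //; ring.
Qed.

Definition add_ideal I (x : R) : set R := [set a * x + u | a in setT & u in I].

Lemma add_ideal_is_ideal I x : is_ideal I -> is_ideal (add_ideal I x).
Proof.
move=> idI; split.
  by exists 0 => //; exists 0; [apply: ideal0 | rewrite mul0r addr0].
move=> c _ _ [a _ [u uI <-]] [b _ [v vI <-]].
exists (c * a + b) => //; exists (c * u + v); last by ring.
by apply: idI.2.
Qed.

Lemma sub_add_ideal I x : I `<=` add_ideal I x.
Proof. by move=> u uI; exists 0 => //; exists u => //; rewrite mul0r add0r. Qed.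

Lemma mem_add_ideal I x : is_ideal I -> add_ideal I x x.
Proof. by move=> idI; exists 1 => //; exists 0; [apply: ideal0 | rewrite mul1r addr0]. Qed.

Lemma maximal_ideal_inv m x : maximal_ideal m -> ~ m x -> exists y, m (1 - y * x).
Proof.
move=> mm mx; have [idm m1] := maximal_ideal_proper mm.
have [[y _ [u um yu]]|n1] := pselect (add_ideal m x 1).
  by exists y; rewrite -yu addrC addKr.
case: mx; have <- : add_ideal m x = m.
  apply: mm.2; last exact: sub_add_ideal.
  by apply/idealr_closedP; split=> //; apply: add_ideal_is_ideal.
exact: mem_add_ideal.
Qed.

Lemma maximal_ideal_prime m x y : maximal_ideal m -> m (x * y) -> m x \/ m y.
Proof.
move=> mm mxy; have [idm m1] := maximal_ideal_proper mm.
have [mx|/(maximal_ideal_inv mm)[z mz]] := pselect (m x); first by left.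
right; have -> : y = y * (1 - z * x) + z * (x * y) by ring.
by apply: idealD => //; apply: ideal_mull.
Qed.

Lemma maximal_ideal_exp m x n : maximal_ideal m -> m (x ^+ n) -> m x.
Proof.
move=> mm; have [_ m1] := maximal_ideal_proper mm.
by elim: n => [|n IHn] //; rewrite exprS => /(maximal_ideal_prime mm)[].
Qed.

(** Zorn's lemma, applied to the proper ideals containing J. The empty set is
    added because the empty chain must have an upper bound too. *)
Lemma maximal_ideal_exists J : is_ideal J -> ~ J 1 ->
  exists2 m, maximal_ideal m & J `<=` m.
Proof.
move=> idJ J1.
pose P : set (set R) := [set A | A = set0 \/ [/\ is_ideal A, ~ A 1 & J `<=` A]].
have [F FP totF|m [Pm maxm]] := @Zorn_bigcup R P.
  have [[A FA A0]|noA] := pselect (exists2 A, F A & A !=set0); last first.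
    left; apply/seteqP; split=> // x [A FA Ax]; case: noA; exists A => //; by exists x.
  right.
  have PA B : F B -> B !=set0 -> [/\ is_ideal B, ~ B 1 & J `<=` B].
    by move=> FB [x Bx]; case: (FP _ FB) => // B0; rewrite B0 in Bx.
  have [idA A1 JA] := PA _ FA A0; split; last by move=> x /JA; exists A.
  - split; first by exists A => //; apply: ideal0.
    move=> a u v [B FB Bu] [C FC Cv].
    have [[idB _ _] [idC _ _]] := (PA _ FB (ex_intro _ _ Bu), PA _ FC (ex_intro _ _ Cv)).
    have [BC|CB] := totF _ _ FB FC.
      by exists C => //; apply: idC.2 => //; apply: BC.
    by exists B => //; apply: idB.2 => //; apply: CB.
  - move=> [B FB B1]; have [_ B1' _] := PA _ FB (ex_intro _ _ B1).
    exact: (B1' B1).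
have PJ : P J by right; split.
case: Pm => [m0|[idm m1 Jm]].
  case: (maxm J) => //; rewrite m0; split=> // J0.
  by have := J0 _ (ideal0 idJ).
exists m => //; split; first exact/idealr_closedP.
move=> I /idealr_closedP[idI I1] mI; apply/seteqP; split=> //.
apply: contrapT => Im; apply: (maxm I); first by split.
by right; split=> // x /Jm/mI.
Qed.

Lemma maximal_ideal_sub m m' : maximal_ideal m -> maximal_ideal m' ->
  m `<=` m' -> m = m'.
Proof. by move=> [_ +] [im' _] mm' => /(_ _ im' mm'). Qed.

(** Prime avoidance: a product of elements that lie in the other ideals but
    not in m is outside m, which is prime. *)
Lemma maximal_ideals_avoid (s : seq (set R)) m : maximal_ideal m ->
  (forall m', m' \in s -> maximal_ideal m' /\ m' <> m) ->
  exists2 x, (forall m', m' \in s -> m' x) & ~ m x.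
Proof.
move=> mm; have [idm m1] := maximal_ideal_proper mm.
elim: s => [|m' s IH] ms; first by exists 1.
have [|x xs mx] := IH; first by move=> k ks; apply: ms; rewrite inE ks orbT.
have [mm' nm'] := ms m' (mem_head _ _).
have [y m'y my] : exists2 y, m' y & ~ m y.
  apply: contrapT => no; apply: nm'; apply: maximal_ideal_sub => // y m'y.
  by apply: contrapT => my; apply: no; exists y.
exists (y * x); last by move=> /(maximal_ideal_prime mm)[].
move=> k; rewrite inE => /orP[/eqP->|ks].
  by apply: ideal_mulr => //; case: (maximal_ideal_proper mm').
apply: ideal_mull; last exact: xs.
have [mk _] : maximal_ideal k /\ k <> m by apply: ms; rewrite inE ks orbT.
by case: (maximal_ideal_proper mk).
Qed.

(** Distinct maximal ideals are comaximal: with y in all ideals of s and 1 - z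
    y in m, an element x of the intersection is x (z y) + (1 - z y) x. *)
Lemma prod_maximal_ideals (s : seq (set R)) : uniq s ->
  (forall m, m \in s -> maximal_ideal m) ->
  \big[@mul_ideal R/setT]_(m <- s) m = [set x | forall m, m \in s -> m x].
Proof.
elim: s => [_ _|m s IH /= /andP[ms us] maxs].
  by rewrite big_nil; apply/seteqP; split.
rewrite big_cons IH // => [|k ks]; last by apply: maxs; rewrite inE ks orbT.
have mm := maxs m (mem_head _ _); have [idm m1] := maximal_ideal_proper mm.
apply/seteqP; split=> x.
  move=> [n [u [v [mu vs ->]]]] k; rewrite inE => ks.
  have kk : maximal_ideal k by apply: maxs; rewrite inE.
  have [idk _] := maximal_ideal_proper kk.
  apply: ideal_sum => // i _; case/orP: ks => [/eqP->|ks]; first exact: ideal_mulr.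
  by apply: ideal_mull => //; apply: vs.
move=> xs; have [|y ys my] := maximal_ideals_avoid (s := s) mm.
  move=> k ks; split; first by apply: maxs; rewrite inE ks orbT.
  by move=> km; rewrite -km ks in ms.
have [z mz] := maximal_ideal_inv mm my.
exists 2, (fun i : 'I_2 => if i == ord0 then x else 1 - z * y),
  (fun i : 'I_2 => if i == ord0 then z * y else x); split.
- by move=> i; case: ifP => // _; apply: xs; rewrite mem_head.
- move=> i k ks; case: ifP => _; last by apply: xs; rewrite inE ks orbT.
  apply: ideal_mull; last exact: ys.
  by case: (@maximal_ideal_proper k) => //; apply: maxs; rewrite inE ks orbT.
- by rewrite big_ord_recl big_ord1 /=; ring.
Qed.
End IdealTheory.

Section Norm.
Local Open Scope classical_set_scope.
Variable R : comNzRingType.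
Implicit Types (I m : set R) (x y : R).

Lemma coset_eqP I x y : is_ideal I ->
  [set z | I (z - x)] = [set z | I (z - y)] <-> I (x - y).
Proof.
move=> idI; split=> [E|Ixy].
  have : [set z | I (z - x)] x by rewrite /= subrr; exact: (ideal0 idI).
  by rewrite E.
apply/seteqP; split=> z /= Iz.
  by rewrite (_ : z - y = (z - x) + (x - y)); [apply: idealD | ring].
by rewrite (_ : z - x = (z - y) - (x - y)); [apply: idealB | ring].
Qed.

Lemma has_normP I n : is_ideal I -> has_norm I n <->
  exists r : 'I_n -> R, (forall x, exists i, I (x - r i)) /\
                        (forall i j, I (r i - r j) -> i = j).
Proof.
move=> idI; split.
  rewrite /has_norm card_eq_sym => /card_set_bijP[f [fB finj fsurj]].
  have rP (i : 'I_n) : exists x, [set y | I (y - x)] = f i.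
    by have [x _ <-] := fB i (ltn_ord i); exists x.
  have [r rE] := choice rP; exists r; split=> [x|i j].
    have [|k kn fk] := fsurj [set y | I (y - x)]; first by exists x.
    exists (Ordinal kn); apply/(coset_eqP _ _ idI).
    by rewrite rE.
  move=> /(coset_eqP _ _ idI); rewrite !rE => fij; apply: val_inj.
  by apply: (finj _ _ _ _ fij); rewrite inE /=; apply: ltn_ord.
move=> [r [rsurj rinj]]; rewrite /has_norm card_eq_sym; apply/card_set_bijP.
exists (fun k => if insub k is Some i then [set y | I (y - r i)] else set0); split.
- by move=> k /= kn; rewrite insubT; exists (r (Sub k kn)).
- move=> k k'; rewrite !inE /= => kn kn'; rewrite !insubT.
  by move/(coset_eqP _ _ idI)/rinj => [].
- move=> _ [x _ <-]; have [i Ii] := rsurj x.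
  exists i; first exact: ltn_ord.
  by rewrite /= valK; apply/esym/(coset_eqP _ _ idI).
Qed.

Lemma has_norm_uniq I n n' : has_norm I n -> has_norm I n' -> n = n'.
Proof.
rewrite /has_norm => In In'; apply/card_eq_II.
by apply: card_eq_trans In'; rewrite card_eq_sym.
Qed.

(** Translation by 1 permutes the n cosets. Comparing the sum of the
    representatives with the sum of their translates gives n in I. *)
Lemma has_norm_mem I n : is_ideal I -> has_norm I n -> I n%:R.
Proof.
move=> idI /(has_normP _ idI)[r [rsurj rinj]].
have [f fP] := choice (fun i : 'I_n => rsurj (r i + 1)).
have f_inj : injective f.
  move=> i j fij; apply: rinj.
  have -> : r i - r j = (r i + 1 - r (f i)) - (r j + 1 - r (f i)) by ring.
  by apply: idealB => //; rewrite fij.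
have : I (\sum_i (r i + 1 - r (f i))) by apply: ideal_sum.
rewrite !(big_split, sumrN) /= sumr_const card_ord (reindex_inj f_inj) /=.
by rewrite addrAC addrN add0r.
Qed.

Lemma coprime_ideal1 I (m n : nat) : is_ideal I -> coprime m n ->
  I m%:R -> I n%:R -> I 1.
Proof.
move=> idI; have [->|m0] := posnP m.
  by rewrite /coprime gcd0n => /eqP->.
move=> mn Im In; have [a b] := egcdnP n m0.
rewrite (eqP mn) => ab _.
have -> : 1 = a%:R * m%:R - b%:R * n%:R :> R.
  by rewrite -!natrM ab natrD addrAC addrN add0r.
by apply: idealB => //; apply: ideal_mull.
Qed.
End Norm.

Section ResidueRing.
Local Open Scope classical_set_scope.
Variables (R : comNzRingType) (m : set R).
Hypothesis idm : idealr_closed [in m].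

Let S : idealr R := HB.pack_for (idealr R) ([in m] : R -> bool) (isIdealr.Build R [in m] idm).

(** The quotient by m, given by its projection; computations in it replace
    congruences modulo m. *)
Lemma residue_ring_exists :
  exists (E : comNzRingType) (f : {rmorphism R -> E}), forall x, f x = 0 <-> m x.
Proof.
exists {ideal_quot S}, (\pi_{ideal_quot S})%qT => x.
rewrite -(rmorph0 (\pi_{ideal_quot S})%qT); split.
  move=> /eqmodP; rewrite /= Quotient.equivE subr0 => xS; exact/set_mem.
by move=> mx; apply/eqmodP; rewrite /= Quotient.equivE subr0; apply/mem_set.
Qed.
End ResidueRing.

Lemma prod_subr_Fp (l : nat) : prime l ->
  'X^l - 'X = \prod_(0 <= k < l) ('X - k%:R%:P) :> {poly 'F_l}.
Proof.
move=> lp; have := finField_genPoly 'F_l; rewrite card_Fp // => ->.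
have -> : index_iota 0 l = index_iota 0 (Zp_trunc (pdiv l)).+2 by rewrite Fp_cast.
rewrite big_mkord.
by apply: eq_bigr => k _; rewrite natr_Zp.
Qed.

(** Fermat's little theorem as an identity of polynomials: the two sides agree
    in F_l[X], so that their difference has coefficients divisible by l. *)
Lemma prod_subr_pchar (E : comNzRingType) (l : nat) (x : E) : l \in [pchar E] ->
  x ^+ l - x = \prod_(0 <= k < l) (x - k%:R).
Proof.
move=> lE; have lp := pcharf_prime lE.
pose h : {poly int} := 'X^l - 'X - \prod_(0 <= k < l) ('X - k%:R%:P).
have map_h (A : comNzRingType) : map_poly intr h =
    'X^l - 'X - \prod_(0 <= k < l) ('X - k%:R%:P) :> {poly A}.
  rewrite /h !rmorphB rmorphXn /= map_polyX rmorph_prod; congr (_ - _ - _).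
  by apply: eq_bigr => k _; rewrite rmorphB /= map_polyX map_polyC /= rmorph_nat.
have h0 : map_poly intr h = 0 :> {poly E}.
  apply/polyP => i; rewrite coef_map coef0 /=; apply/eqP.
  rewrite -(dvdz_pcharf lE) (dvdz_pcharf (pchar_Fp lp)).
  by rewrite -coef_map /= map_h prod_subr_Fp // subrr coef0.
have := congr1 (horner^~ x) h0; rewrite map_h !hornerE horner_prod => /eqP.
rewrite subr_eq0 => /eqP->.
by apply: eq_bigr => k _; rewrite !hornerE.
Qed.

Section ResidueField.
Local Open Scope classical_set_scope.
Variables (R : comNzRingType) (m : set R) (l : nat).
Hypotheses (mm : maximal_ideal m) (l_prime : prime l) (ml : m l%:R).

Let idm := (maximal_ideal_proper mm).1.
Let m1 := (maximal_ideal_proper mm).2.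

(** By [prod_subr_pchar] the product of the x - i lies in m, which is prime. *)
Lemma prime_residue x : m (x ^+ l - x) -> exists i : 'I_l, m (x - i%:R).
Proof.
have [E [f fm]] := residue_ring_exists mm.1.
have lE : l \in [pchar E].
  by rewrite inE l_prime -(rmorph_nat f); apply/eqP/fm.
move=> /fm; rewrite rmorphB rmorphXn (prod_subr_pchar _ lE) => fx.
have : m (\prod_(i < l) (x - i%:R)).
  apply/fm; rewrite rmorph_prod -[RHS]fx big_mkord.
  by apply: eq_bigr => i _; rewrite rmorphB rmorph_nat.
elim/big_rec: _ => [/m1//|i y _ IHy /(maximal_ideal_prime mm)[mi|/IHy//]].
by exists i.
Qed.

Lemma natr_inj_mod (i j : nat) : (i < l)%N -> (j < l)%N -> m (i%:R - j%:R) -> i = j.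
Proof.
wlog ij : i j / (i <= j)%N => [wl|] il jl mij.
  have [ij|/ltnW ji] := leqP i j; first exact: wl.
  by apply/esym/wl => //; rewrite -opprB; apply: idealN.
apply/eqP; rewrite eqn_leq ij leqNgt; apply/negP => ltij.
case: m1; apply: (coprime_ideal1 (m := l) (n := j - i)%N) => //.
  rewrite prime_coprime // gtnNdvd ?subn_gt0 //.
  by apply: leq_ltn_trans jl; apply: leq_subr.
by rewrite natrB // -opprB; apply: idealN.
Qed.

Lemma has_norm_prime : (forall x, m (x ^+ l - x)) -> has_norm m l.
Proof.
move=> fix_l; apply/has_normP => //; exists (fun i => i%:R); split=> [x|i j mij].
  exact: prime_residue.
by apply: val_inj; apply: natr_inj_mod mij; apply: ltn_ord.
Qed.

(** With F the Frobenius map, an involution, and d = F g - g, one has F d = -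
    d. For any x the quotient (F x - x) / d is fixed by F, so it is an integer
    j modulo m; then x - j g is fixed by F, so it is an integer i. The classes
    are those of j g + i with 0 <= i, j < l. *)
Lemma has_norm_prime_sqr (g : R) : (forall x, m (x ^+ (l ^ 2) - x)) ->
  ~ m (g ^+ l - g) -> has_norm m (l ^ 2).
Proof.
move=> fix_l2 gl; have l0 := prime_gt0 l_prime.
have [E [f fm]] := residue_ring_exists mm.1.
have lE : l \in [pchar E].
  by rewrite inE l_prime -(rmorph_nat f); apply/eqP/fm.
pose F : {rmorphism E -> E} := pFrobenius_aut lE.
have fF y : y ^+ l = F y by rewrite /F /= pFrobenius_autE.
have fE x : f x ^+ l = F (f x) by [].
have f2 x : F (F (f x)) = f x.
  rewrite -!fF -exprM mulnn; apply/eqP; rewrite -subr_eq0.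
  by rewrite -rmorphXn -rmorphB; apply/eqP/fm.
(* e is an inverse of g ^+ l - g modulo m. *)
have [e me] := maximal_ideal_inv mm gl.
have {}me : 1 = f e * (F (f g) - f g).
  move/fm/eqP: me; rewrite rmorphB rmorph1 subr_eq0 => /eqP->.
  by rewrite rmorphM rmorphB rmorphXn fE.
have nat_frob (j : nat) : F j%:R = j%:R by rewrite rmorph_nat.
apply/has_normP => //.
have bnd (k : 'I_(l ^ 2)) : (k %/ l < l)%N by rewrite ltn_divLR // mulnn.
have bnd' (k : nat) : (k %% l < l)%N by rewrite ltn_mod.
exists (fun k => (k %/ l)%:R * g + (k %% l)%:R); split=> [x|k k'].
  have [|j mj] := @prime_residue ((x ^+ l - x) * e).
    apply/fm; rewrite rmorphB rmorphXn fE.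
    have dF : F (f g) - f g = - F (F (f g) - f g) by rewrite rmorphB f2 opprB.
    have Fe : F (f e) = - f e.
      have E1 : 1 = - F (f e) * (F (f g) - f g).
        by rewrite mulNr -mulrN dF opprK -rmorphM -me rmorph1.
      by rewrite -[LHS]opprK -[- F _]mulr1 me mulrCA -E1 mulr1.
    rewrite !rmorphM Fe !rmorphB rmorphXn fE f2; ring.
  have {mj} jE : j%:R = (F (f x) - f x) * f e.
    move/fm/eqP: mj; rewrite rmorphB rmorphM rmorphB rmorphXn rmorph_nat fE.
    by rewrite subr_eq0 => /eqP.
  have [|i mi] := @prime_residue (x - j%:R * g).
    apply/fm; rewrite rmorphB rmorphXn fE rmorphB rmorphM rmorph_nat.
    rewrite rmorphB rmorphM nat_frob.
    transitivity ((F (f x) - f x) * 1 - j%:R * (F (f g) - f g)); first by ring.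
    by rewrite {1}me jE; ring.
  have kl : (j * l + i < l ^ 2)%N.
    by rewrite -mulnn (leq_trans _ (leq_mul (ltn_ord j) (leqnn l))) // mulSn addnC ltn_add2r.
  exists (Ordinal kl); rewrite /= divnMDl // divn_small // addn0 modnMDl modn_small //.
  by rewrite opprD addrA.
pose j := (k %/ l)%N; pose j' := (k' %/ l)%N.
pose i := (k %% l)%N; pose i' := (k' %% l)%N.
rewrite -/j -/j' -/i -/i' => mkk.
have jj' : j = j'.
  apply: natr_inj_mod; rewrite ?bnd //.
  suff : m ((j%:R - j'%:R) * (g ^+ l - g)) by case/(maximal_ideal_prime mm).
  apply/fm; move/fm: mkk => mkk.
  have : F (f (j%:R * g + i%:R - (j'%:R * g + i'%:R))) -
         f (j%:R * g + i%:R - (j'%:R * g + i'%:R)) = 0 by rewrite mkk rmorph0 subrr.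
  rewrite rmorphM !rmorphB !rmorphD !rmorphM !rmorph_nat rmorphXn fE.
  move=> <-; ring.
have ii' : i = i'.
  apply: natr_inj_mod; rewrite ?bnd' //.
  by move: mkk; rewrite jj' opprD addrACA subrr add0r.
by apply: val_inj; rewrite /= (divn_eq k l) (divn_eq k' l) -/j -/j' -/i -/i' jj' ii'.
Qed.
End ResidueField.

(** * Ostrowski ideals generated by one element *)

Section Criterion.
Local Open Scope classical_set_scope.
Variables (R : comNzRingType) (l : nat) (pi : R).
Hypothesis l_prime : prime l.
Hypothesis pi_dvd_l : exists c, l%:R = pi * c.
Hypothesis l_dvd_pi2 : exists c, pi ^+ 2 = l%:R * c.
Hypothesis frob2 : forall x, exists c, x ^+ (l ^ 2) - x = pi * c.

Let pi_mem m : maximal_ideal m -> m l%:R -> m pi.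
Proof.
move=> mm ml; apply: (maximal_ideal_exp (n := 2) mm).
have [c ->] := l_dvd_pi2; apply: ideal_mulr => //.
by case: (maximal_ideal_proper mm).
Qed.

(** If x belongs to all maximal ideals over l, put e = x ^+ (l ^ 2).-1, so
    that e x = x modulo pi. The ideal generated by pi and 1 - e is contained
    in no maximal ideal, since such an ideal would contain l, hence x, hence e
    and 1. Write 1 = u pi + v (1 - e) and multiply by x. *)
Lemma maximal_ideals_meet :
  [set x | forall m, maximal_ideal m -> m l%:R -> m x] = range ( *%R pi).
Proof.
apply/seteqP; split=> [x xm|_ [c _ <-] m mm ml]; last first.
  by apply: ideal_mulr; [case: (maximal_ideal_proper mm) | apply: pi_mem].
have idpi := principal_is_ideal pi.
pose e := x ^+ (l ^ 2).-1.
have l2 : (1 < l ^ 2)%N by have := prime_gt1 l_prime; rewrite -mulnn; nia.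
have ex : e * x = x ^+ (l ^ 2) by rewrite -exprSr prednK // ltnW.
have idJ := add_ideal_is_ideal (1 - e) idpi.
have [[v _ [_ [u _ <-] uv]]|J1] := pselect (add_ideal (range ( *%R pi)) (1 - e) 1).
  have [c xc] := frob2 x.
  have -> : x = x * (v * (1 - e) + pi * u) by rewrite uv mulr1.
  exists (x * u - v * c) => //.
  rewrite mulrBr [pi * (v * c)]mulrCA -xc -ex; ring.
have [m mm Jm] := maximal_ideal_exists idJ J1.
have [idm m1] := maximal_ideal_proper mm.
have ml : m l%:R.
  have [c ->] := pi_dvd_l; apply/Jm/sub_add_ideal.
  by exists c.
case: m1; have -> : 1 = (1 - e) + e by ring.
apply: idealD => //; first by apply: Jm; apply: mem_add_ideal.
by rewrite /e -(subnKC l2) /= exprS; apply: ideal_mulr => //; apply: xm.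
Qed.

(** Under the two alternatives all maximal ideals over l have norm l, resp. l
    ^ 2. The product is therefore empty or ranges over all maximal ideals over
    l, and it is their intersection, which is (pi). If these were infinitely
    many, the finitely supported product would be the unit ideal by
    convention. *)
Lemma prod_of_norm_principal (f : nat) :
  (forall x : R, exists c, x ^+ l - x = pi * c) \/
  (exists g : R, forall m, maximal_ideal m -> m l%:R -> ~ m (g ^+ l - g)) ->
  principal_ideal (\big[@mul_ideal R/setT]_(m \in
    [set m : set R | maximal_ideal m /\ has_norm m (l ^ f)]) m).
Proof.
move=> split_inert.
have over_l (m : set R) n : maximal_ideal m -> has_norm m (l ^ n) -> m l%:R.
  move=> mm mn; have [idm m1] := maximal_ideal_proper mm.
  by have := has_norm_mem idm mn; rewrite natrX => /(maximal_ideal_exp mm).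
have [k normk] : exists k, forall m : set R, maximal_ideal m -> m l%:R -> has_norm m (l ^ k).
  have mul_mem m x : maximal_ideal m -> m l%:R -> (exists c, x = pi * c) -> m x.
    move=> mm ml [c ->]; apply: ideal_mulr; last exact: pi_mem.
    by case: (maximal_ideal_proper mm).
  case: split_inert => [split_l|[g gm]].
    by exists 1%N => m mm ml; apply: has_norm_prime => // x; apply: mul_mem.
  exists 2%N => m mm ml; apply: (@has_norm_prime_sqr _ _ _ mm l_prime ml g).
    by move=> x; apply: mul_mem.
  exact: gm.
have unit_principal : principal_ideal [set: R].
  by exists 1; apply/seteqP; split=> x //= _; exists x; rewrite ?mul1r.
case: finite_supportP => [_|X XP _ XE]; first by rewrite big_nil.
have memX m : m \in X <-> maximal_ideal m /\ has_norm m (l ^ f).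
  split=> [mX|[mm mf]]; first exact: XP.
  suff : [set` X] m by [].
  rewrite XE; split=> //= mT; case: (maximal_ideal_proper mm) => _; apply.
  by rewrite mT.
rewrite prod_maximal_ideals ?fset_uniq //; last by move=> m /memX[].
have [[m0 /memX[mm0 m0f]]|noX] := pselect (exists m, m \in X); last first.
  suff -> : [set x | forall m, m \in X -> m x] = setT by [].
  by apply/seteqP; split=> x // _ m mX; case: noX; exists m.
have fk : (l ^ f = l ^ k)%N.
  exact: has_norm_uniq m0f (normk _ mm0 (over_l _ _ mm0 m0f)).
exists pi; rewrite -maximal_ideals_meet; apply/seteqP; split=> x xX m.
  by move=> mm ml; apply: xX; apply/memX; rewrite fk; split=> //; apply: normk.
by move=> /memX[mm mf]; apply: xX => //; apply: over_l mf.
Qed.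
End Criterion.

(** Congruences modulo pi, where pi divides the prime l: the Frobenius map
    x |-> x ^+ l is then additive, and the elements fixed by one of its iterates
    form a subring. *)
Section Frobenius.
Variables (R : comNzRingType) (l : nat) (pi : R).
Hypotheses (l_prime : prime l) (pi_dvd_l : exists c, l%:R = pi * c).

Definition eqpi (x y : R) : Prop := exists c, x - y = pi * c.

Lemma eqpi_refl x : eqpi x x.
Proof. by exists 0; rewrite subrr mulr0. Qed.

Lemma eqpi_sym x y : eqpi x y -> eqpi y x.
Proof. by case=> c E; exists (- c); rewrite mulrN -E opprB. Qed.

Lemma eqpi_trans y x z : eqpi x y -> eqpi y z -> eqpi x z.
Proof.
by case=> c E [d F]; exists (c + d); rewrite mulrDr -E -F addrA subrK.
Qed.

Lemma eqpiD x y x' y' : eqpi x x' -> eqpi y y' -> eqpi (x + y) (x' + y').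
Proof. by case=> c E [d F]; exists (c + d); rewrite mulrDr -E -F; ring. Qed.

Lemma eqpiN x y : eqpi x y -> eqpi (- x) (- y).
Proof. by case=> c E; exists (- c); rewrite mulrN -E; ring. Qed.

Lemma eqpiM x y x' y' : eqpi x x' -> eqpi y y' -> eqpi (x * y) (x' * y').
Proof.
case=> c E [d F]; exists (c * y + x' * d).
by rewrite mulrDr mulrA -E mulrCA -F; ring.
Qed.

Lemma eqpiX n x x' : eqpi x x' -> eqpi (x ^+ n) (x' ^+ n).
Proof.
move=> xx'; elim: n => [|n IHn]; first exact: eqpi_refl.
by rewrite !exprS; apply: eqpiM.
Qed.

Lemma eqpi_l x y c : x - y = l%:R * c -> eqpi x y.
Proof. by rewrite /eqpi => ->; have [d ->] := pi_dvd_l; exists (d * c); rewrite mulrA. Qed.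

Lemma exprD_prime (x y : R) : exists c, (x + y) ^+ l = x ^+ l + y ^+ l + l%:R * c.
Proof.
have l0 := prime_gt0 l_prime.
have bin i : (0 < i < l)%N -> exists k, 'C(l, i) = (k * l)%N.
  by move=> il; apply/dvdnP; rewrite prime_dvd_bin.
rewrite exprDn -(big_mkord xpredT (fun i => x ^+ (l - i) * y ^+ i *+ 'C(l, i))).
rewrite big_nat_recr //= big_ltn //.
rewrite subn0 subnn !expr0 mulr1 mul1r bin0 binn !mulr1n addrAC.
have [c ->] : exists c, \sum_(1 <= i < l) x ^+ (l - i) * y ^+ i *+ 'C(l, i) = l%:R * c;
  last by exists c.
rewrite big_nat; elim/big_rec: _ => [|i s il [c ->]]; first by exists 0; rewrite mulr0.
have [k ->] := bin i il.
by exists (x ^+ (l - i) * y ^+ i *+ k + c); rewrite mulrnA mulrDr !mulr_natl.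
Qed.

Lemma eqpi_exprD n (x y : R) :
  eqpi ((x + y) ^+ (l ^ n)) (x ^+ (l ^ n) + y ^+ (l ^ n)).
Proof.
elim: n => [|n IHn]; first by rewrite !expr1; apply: eqpi_refl.
rewrite expnSr !exprM; apply: eqpi_trans (eqpiX _ IHn) _.
have [c ->] := exprD_prime (x ^+ (l ^ n)) (y ^+ (l ^ n)).
by apply: (@eqpi_l _ _ c); rewrite addrC addKr.
Qed.

Variable n : nat.
Definition frobenius_fixed (x : R) : Prop := eqpi (x ^+ (l ^ n)) x.

Lemma frobenius_fixed_eqpi x y : eqpi x y -> frobenius_fixed y -> frobenius_fixed x.
Proof.
move=> xy fy; apply: eqpi_trans (eqpiX _ xy) _.
exact: eqpi_trans fy (eqpi_sym xy).
Qed.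

Lemma frobenius_fixedD x y :
  frobenius_fixed x -> frobenius_fixed y -> frobenius_fixed (x + y).
Proof. by move=> fx fy; apply: eqpi_trans (eqpi_exprD _ _ _) (eqpiD fx fy). Qed.

Lemma frobenius_fixedM x y :
  frobenius_fixed x -> frobenius_fixed y -> frobenius_fixed (x * y).
Proof. by move=> fx fy; rewrite /frobenius_fixed exprMn; apply: eqpiM. Qed.

Lemma frobenius_fixed_nat k : frobenius_fixed k%:R.
Proof.
elim: k => [|k IHk]; last first.
  rewrite mulrS; apply: frobenius_fixedD => //.
  by rewrite /frobenius_fixed expr1n; apply: eqpi_refl.
by rewrite /frobenius_fixed expr0n expn_eq0 eqn0Ngt prime_gt0 //; apply: eqpi_refl.
Qed.

Lemma frobenius_fixed_int (z : int) : frobenius_fixed z%:~R.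
Proof.
have l0 : l%:Z != 0 by rewrite -lt0n prime_gt0.
apply: (@frobenius_fixed_eqpi _ `|(z %% l)%Z|%N%:R); last exact: frobenius_fixed_nat.
apply: (@eqpi_l _ _ (z %/ l)%Z%:~R).
rewrite (pmulrn _ `|_|%N) gez0_abs ?modz_ge0 // {1}(divz_eq z l).
by rewrite !(rmorphD, rmorphM) /= addrK mulrC.
Qed.
End Frobenius.

Lemma frobenius_fixed_iter (R : comNzRingType) (l : nat) (pi x : R) :
  frobenius_fixed l pi 1 x -> frobenius_fixed l pi 2 x.
Proof.
move=> fx; rewrite /frobenius_fixed -mulnn exprM.
exact: eqpi_trans (eqpiX _ fx) fx.
Qed.

(** x ^+ l = x (x ^+ 2) ^+ l./2 = x N ^+ l./2, and Euler's criterion applies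
    to N. *)
Lemma frobenius_sqrt (R : comNzRingType) (l N : nat) (x : R) : prime l -> odd l ->
  x ^+ 2 = N%:R -> exists c, x ^+ l = (legendre N l)%:~R * x + l%:R * c.
Proof.
move=> lp lo xN.
have /dvdzP[z zE] : (l%:Z %| N%:Z ^+ l./2 - legendre N l)%Z.
  rewrite -eqz_mod_dvd -intr_Fp_eq // rmorphXn /=.
  by rewrite legendre_Fp.
exists (z%:~R * x).
rewrite -[l in LHS]odd_double_half lo exprS -mul2n exprM xN.
have -> : N%:R ^+ l./2 = (N%:Z ^+ l./2)%:~R :> R by rewrite rmorphXn.
have -> : N%:Z ^+ l./2 = legendre N l + z * l by rewrite -zE addrC subrK.
by rewrite rmorphD rmorphM /= -pmulrn; ring.
Qed.

(** The Frobenius map sends x to x, to - x, or to 0 when l divides N, in which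
    case x itself vanishes modulo pi. If it sends x to - x, then x is not
    fixed modulo any maximal ideal over l, because 2 x is invertible there. *)
Lemma frobenius_fixed_sqrt (R : comNzRingType) (l N : nat) (pi x : R) :
  prime l -> odd l -> (exists c, l%:R = pi * c) -> x ^+ 2 = N%:R ->
  ((l %| N)%N -> exists c, x = pi * c) ->
  frobenius_fixed l pi 2 x /\
  (frobenius_fixed l pi 1 x \/
   forall m, maximal_ideal m -> m l%:R -> ~ m (x ^+ l - x)).
Proof.
move=> lp lo pl xN lN; have [c xc] := frobenius_sqrt lp lo xN.
have := legendre_val l N; rewrite !inE; case/or3P=> /eqP leg.
- have [d xd] : exists d, x = pi * d.
    by apply: lN; move/eqP: leg; rewrite legendre_eq0.
  have fx : frobenius_fixed l pi 1 x.
    exists (d * (x ^+ l.-1 - 1)).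
    by rewrite expn1 mulrA -xd mulrBr mulr1 -exprS prednK // prime_gt0.
  by split; [apply: frobenius_fixed_iter | left].
- have fx : frobenius_fixed l pi 1 x.
    apply: (@eqpi_l _ _ _ pl _ _ c).
    by rewrite expn1 xc leg mul1r addrC addKr.
  by split; [apply: frobenius_fixed_iter | left].
rewrite leg mulN1r in xc.
have fx : eqpi pi (x ^+ l) (- x).
  by apply: (@eqpi_l _ _ _ pl _ _ c); rewrite xc addrC addKr.
split.
  rewrite /frobenius_fixed -mulnn exprM; apply: eqpi_trans (eqpiX _ fx) _.
  rewrite exprNn -signr_odd lo mulN1r -{2}[x]opprK.
  exact: eqpiN.
right=> m mm ml mx; have [idm m1] := maximal_ideal_proper mm.
have mnat (k : nat) : coprime l k -> ~ m k%:R.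
  by move=> lk mk; apply: m1; apply: coprime_ideal1 lk ml mk.
have : m (2%:R * x).
  have -> : 2%:R * x = l%:R * c - (x ^+ l - x) by rewrite xc; ring.
  by apply: idealB => //; apply: ideal_mulr.
case/(maximal_ideal_prime mm); first by apply: mnat; rewrite coprimen2.
move=> mx'; apply: (mnat N).
  rewrite prime_coprime //; move/eqP: leg; apply: contraTN => lN'.
  by rewrite /legendre (_ : (l%:Z %| N%:Z)%Z).
by rewrite -xN; apply: ideal_mull.
Qed.

(** * Integers of a biquadratic field *)

Section Integers.
Variable K : fieldExtType rat.

Local Notation O := (@integer_pred K).

(** A rational number that is integral over the integers is an integer; this
    is transported from algebraic numbers. *)
Lemma integral_rat_int (u : rat) : u%:A \in O -> exists n : int, u = n%:~R.
Proof.
rewrite unfold_in => /asboolP[p pm pu].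
have {}pu : root (map_poly intr p) u.
  move: pu; have -> : map_poly intr p = map_poly (in_alg K) (map_poly intr p).
    by rewrite -map_poly_comp; apply: eq_map_poly => i; rewrite -[LHS](rmorph_int (in_alg K)).
  by rewrite -in_algE fmorph_root.
have : (ratr u : algC) \in Num.int.
  apply: Cint_rat_Aint; first by apply/CratP; exists u.
  apply: (@root_monic_Aint (map_poly intr p : {poly algC})).
  - move: pu; rewrite -(fmorph_root (ratr : {rmorphism rat -> algC})) -map_poly_comp.
    by rewrite (@eq_map_poly _ _ _ intr) // => i /=; rewrite rmorph_int.
  - exact: monic_map.
  - by apply/polyOverP => i; rewrite coef_map /= intr_int.
move=> /intrP[n un]; exists n; apply: (fmorph_inj (ratr : {rmorphism rat -> algC})).
by rewrite /= un rmorph_int.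
Qed.

Lemma integral_sqrt (x : K) : x ^+ 2 \in O -> x \in O.
Proof.
rewrite !unfold_in => /asboolP x2; apply/asboolP.
apply: (@integral_root_monic _ _ _ x ('X^2 - (x ^+ 2)%:P)).
- by rewrite monicE lead_coefDl ?lead_coefXn // size_polyXn size_polyN (leq_ltn_trans (size_polyC_leq1 _)).
- by rewrite /root !hornerE subrr.
move=> c /(nthP 0)[i _ <-]; rewrite coefB coefXn coefC.
apply: integral_sub; first exact: integral_nat.
by case: ifP => _ //; apply: integral0.
Qed.

Lemma integer_rmorph (f : {rmorphism K -> K}) (x : K) : x \in O -> f x \in O.
Proof.
rewrite !unfold_in => /asboolP[p pm px]; apply/asboolP; exists p => //.
have -> : map_poly intr p = map_poly f (map_poly intr p) :> {poly K}.
  by rewrite -map_poly_comp; apply: eq_map_poly => i /=; rewrite rmorph_int.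
by rewrite rmorph_root.
Qed.

End Integers.

Section QuadraticExtension.
Variables (F : fieldType) (L : fieldExtType F) (E : {subfield L}) (x : L).
Hypothesis x2 : x ^+ 2 \in E.

Lemma quadratic_decomp y : y \in <<E; x>>%VS ->
  exists u v, [/\ u \in E, v \in E & y = u + v * x].
Proof.
move=> /Fadjoin_polyP[p /polyOverP pE ->]; rewrite horner_coef.
elim/big_ind: _ => [|y1 y2 [u [v [uE vE ->]]] [u' [v' [uE' vE' ->]]]|i _].
- by exists 0, 0; rewrite !rpred0 mul0r addr0.
- by exists (u + u'), (v + v'); rewrite !rpredD //; split=> //; ring.
have xi : (x ^+ 2) ^+ (i./2) \in E by rewrite rpredX.
rewrite -[X in x ^+ X]odd_double_half exprD -mul2n exprM.
case: (odd i).
  exists 0, (p`_i * (x ^+ 2) ^+ i./2); split; rewrite ?rpred0 ?rpredM //.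
  by rewrite expr1 add0r; ring.
exists (p`_i * (x ^+ 2) ^+ i./2), 0; split; rewrite ?rpred0 ?rpredM //.
by rewrite expr0 mul1r mul0r addr0.
Qed.

(** The polynomial X ^+ 2 - x ^+ 2 is the minimal polynomial of x over E, and
    - x is its other root. *)
Lemma quadratic_conj : x \notin E -> <<E; x>>%VS = {:L}%VS ->
  exists f : {rmorphism L -> L}, {in E, forall y, f y = y} /\ f x = - x.
Proof.
move=> xE Ex.
have Qover : 'X^2 - (x ^+ 2)%:P \is a polyOver E.
  by rewrite rpredB ?polyOverXn ?polyOverC.
have Qx : root ('X^2 - (x ^+ 2)%:P) x by rewrite /root !hornerE subrr.
have Qmx : root ('X^2 - (x ^+ 2)%:P) (- x) by rewrite /root !hornerE sqrrN subrr.
have min_dvd := minPoly_dvdp Qover Qx.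
have sizeQ : size ('X^2 - (x ^+ 2)%:P) = 3%N.
  by rewrite size_polyDl ?size_polyXn // size_polyN (leq_ltn_trans (size_polyC_leq1 _)).
have min_eq : minPoly E x %= 'X^2 - (x ^+ 2)%:P.
  have le3 : (size (minPoly E x) <= 3)%N.
    by rewrite -sizeQ dvdp_leq // -size_poly_gt0 sizeQ.
  rewrite -dvdp_size_eqp // sizeQ eqn_leq le3 size_minPoly ltnS.
  by rewrite ltn_neqAle eq_sym adjoin_deg_eq1 xE.
have rootm : root (map_poly \1%VF (minPoly E x)) (- x).
  rewrite (eq_map_poly (g := id)) => [|z]; last by rewrite lfunE.
  by rewrite map_poly_id // (eqp_root min_eq).
have := kHomExtendP (sub1v E) (kHom1 1 E) rootm.
rewrite Ex => homf.
have fM : monoid_morphism (kHomExtend E \1 x (- x)) by apply/kHom_monoid_morphism.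
pose f : {rmorphism L -> L} := HB.pack (fun_of_lfun (kHomExtend E \1 x (- x)))
  (GRing.isMonoidMorphism.Build _ _ _ fM).
exists f; split=> [y yE|] /=; last by rewrite (kHomExtend_val (kHom1 1 E) rootm).
by rewrite kHomExtend_id // lfunE.
Qed.
End QuadraticExtension.

Section Biquadratic.
Variables (K : fieldExtType rat) (A B : nat) (a b : K).
Hypotheses (a_sqrt : a ^+ 2 = A%:R) (b_sqrt : b ^+ 2 = B%:R).
Hypothesis K_gen : <<1 & [:: a; b]>>%VS = {:K}%VS.
Hypotheses (sqfA : squarefree A) (sqfB : squarefree B).
Hypotheses (A_mod4 : (A %% 4 = 2)%N) (B_mod4 : (B %% 4 = 1)%N).
Hypothesis coprime_AB : coprime A B.
Hypotheses (A_nonsquare : forall n, (n ^ 2)%N <> A)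
  (B_nonsquare : forall n, (n ^ 2)%N <> B)
  (AB_nonsquare : forall n, (n ^ 2)%N <> (A * B)%N).

Local Notation Opred := (@integer_pred K).
Let iota : {rmorphism rat -> K} := in_alg K.

Let A0 : (0 < A)%N. Proof. by case: (A) A_mod4. Qed.
Let B0 : (0 < B)%N. Proof. by case: (B) B_mod4. Qed.
Let K_nat_neq0 n : (0 < n)%N -> n%:R != 0 :> K.
Proof. by move=> n0; rewrite -(rmorph_nat iota) fmorph_eq0 pnatr_eq0 -lt0n. Qed.

Lemma nat_integer (n : nat) : n%:R \in Opred. Proof. exact: rpred_nat. Qed.

Lemma a_integer : a \in Opred. Proof. by apply: integral_sqrt; rewrite a_sqrt nat_integer. Qed.
Lemma b_integer : b \in Opred. Proof. by apply: integral_sqrt; rewrite b_sqrt nat_integer. Qed.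

Let iota_int u : iota u \in Opred -> exists n : int, u = n%:~R.
Proof. exact: integral_rat_int. Qed.

Lemma nonsquare_rat (n : nat) (u : rat) :
  (forall k, (k ^ 2)%N <> n) -> u ^+ 2 = n%:R -> False.
Proof.
move=> nsq un.
have /iota_int[k uk] : iota u \in Opred.
  by apply: integral_sqrt; rewrite -rmorphXn un rmorph_nat nat_integer.
have kn : k ^+ 2 = n%:Z.
  by apply: (@intr_inj rat); rewrite rmorphXn /= -uk un -pmulrn.
by apply: (nsq `|k|%N); rewrite -abszX kn.
Qed.

Let in1 (x : K) : x \in 1%AS -> exists u, x = iota u.
Proof. by move=> /vlineP[u ->]; exists u. Qed.
Let nat_in E n : n%:R \in (E : {subfield K}). Proof. exact: rpred_nat. Qed.

Lemma a_notin1 : a \notin 1%AS.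
Proof.
apply/negP => /in1[u au]; apply: (@nonsquare_rat _ u A_nonsquare).
by apply: (fmorph_inj iota); rewrite rmorphXn -au a_sqrt rmorph_nat.
Qed.

Lemma b_notin1 : b \notin 1%AS.
Proof.
apply/negP => /in1[u bu]; apply: (@nonsquare_rat _ u B_nonsquare).
by apply: (fmorph_inj iota); rewrite rmorphXn -bu b_sqrt rmorph_nat.
Qed.

(** If y = u + v x with u, v rational, squaring gives u v = 0, because x is
    irrational; then n or m n is the square of a rational number. *)
Let notin_ext (x y : K) (m n : nat) : x ^+ 2 = m%:R -> y ^+ 2 = n%:R ->
  x \notin 1%AS -> (forall k, (k ^ 2)%N <> n) -> (0 < m)%N ->
  (forall k, (k ^ 2)%N <> (m * n)%N) -> y \notin <<1; x>>%AS.
Proof.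
move=> xm yn x1 nnsq m0 mnnsq; apply/negP => yx.
have x2 : x ^+ 2 \in 1%AS by rewrite xm nat_in.
have [_ [_ [/in1[u ->] /in1[v ->] yE]]] := quadratic_decomp x2 yx.
have E : n%:R = iota (u ^+ 2 + v ^+ 2 * m%:R) + iota (2 * u * v) * x.
  by rewrite -yn yE !(rmorphD, rmorphM, rmorphXn, rmorph_nat) -xm; ring.
have uv0 : 2 * u * v = 0.
  apply: contraNeq x1 => uv0.
  have -> : x = iota ((n%:R - (u ^+ 2 + v ^+ 2 * m%:R)) / (2 * u * v)).
    rewrite fmorph_div rmorphB rmorph_nat E addrC addKr mulrAC divff ?mul1r //.
    by rewrite fmorph_eq0.
  by apply/vlineP; eexists.
move: E; rewrite uv0 rmorph0 mul0r addr0 -(rmorph_nat iota) => /fmorph_inj E.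
move/eqP: uv0; rewrite -mulrA mulf_eq0 /= mulf_eq0 => /orP[/eqP u0|/eqP v0].
  apply: (@nonsquare_rat _ (v * m%:R) mnnsq).
  by rewrite natrM E u0; ring.
by apply: (@nonsquare_rat _ u nnsq); rewrite E v0; ring.
Qed.

Lemma gen_ba : <<<<1; a>>; b>>%VS = {:K}%VS.
Proof. by rewrite -K_gen adjoin_cons adjoin_seq1. Qed.

Lemma gen_ab : <<<<1; b>>; a>>%VS = {:K}%VS.
Proof. by rewrite -gen_ba adjoinC. Qed.

Lemma conj_b : exists tau : {rmorphism K -> K}, tau a = a /\ tau b = - b.
Proof.
have [||tau [fixE tau_b]] := @quadratic_conj _ _ <<1; a>>%AS b _ _ gen_ba.
- by rewrite b_sqrt nat_in.
- exact: notin_ext a_sqrt b_sqrt a_notin1 B_nonsquare A0 AB_nonsquare.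
by exists tau; split=> //; apply: fixE; apply: memv_adjoin.
Qed.

Lemma conj_a : exists sigma : {rmorphism K -> K}, sigma b = b /\ sigma a = - a.
Proof.
have [||sigma [fixE sigma_a]] := @quadratic_conj _ _ <<1; b>>%AS a _ _ gen_ab.
- by rewrite a_sqrt nat_in.
- by apply: notin_ext b_sqrt a_sqrt b_notin1 A_nonsquare B0 _ => k; rewrite mulnC.
by exists sigma; split=> //; apply: fixE; apply: memv_adjoin.
Qed.

Lemma biquadratic_decomp x : exists u0 u1 u2 u3 : rat,
  x = (iota u0 + iota u1 * b) + a * (iota u2 + iota u3 * b).
Proof.
have xK : x \in <<<<1; a>>; b>>%VS by rewrite gen_ba memvf.
have b2 : b ^+ 2 \in <<1; a>>%AS by rewrite b_sqrt nat_in.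
have [y [z [ya za ->]]] := quadratic_decomp b2 xK.
have a2 : a ^+ 2 \in 1%AS by rewrite a_sqrt nat_in.
have [_ [_ [/in1[u0 ->] /in1[u2 ->] ->]]] := quadratic_decomp a2 ya.
have [_ [_ [/in1[u1 ->] /in1[u3 ->] ->]]] := quadratic_decomp a2 za.
by exists u0, u1, u2, u3; ring.
Qed.

Let irr_b (u v : rat) : iota u + iota v * b = 0 -> u = 0 /\ v = 0.
Proof.
move=> uv; have v0 : v = 0.
  apply: contraNeq b_notin1 => v0; apply/vlineP; exists (- u / v).
  have iv0 : iota v != 0 by rewrite fmorph_eq0.
  apply: (mulfI iv0); rewrite -[(_ / _)%:A]/(iota (- u / v)) -rmorphM.
  rewrite [v * _]mulrC divfK // rmorphN; apply/eqP.
  by rewrite -subr_eq0 opprK addrC uv.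
by move: uv; rewrite v0 rmorph0 mul0r addr0 => /eqP; rewrite fmorph_eq0 => /eqP.
Qed.

Definition omega : K := (1 + b) / 2%:R.
(** The elements of Z[w], the ring of integers of Q(b), where B = 4 c + 1. *)
Definition zomega (m n : int) : K := m%:~R + n%:~R * omega.
Let c : int := (B %/ 4)%N.
Let B_eq : B%:Z = 4 * c + 1. Proof. by rewrite /c; lia. Qed.
Let K2 : 2%:R != 0 :> K. Proof. exact: K_nat_neq0. Qed.

Lemma omega_sqr : omega ^+ 2 = omega + c%:~R.
Proof.
rewrite /omega; have /(congr1 (intr : int -> K)) := B_eq.
rewrite -pmulrn -b_sqrt rmorphD rmorphM /= => b2.
have -> : c%:~R = (b ^+ 2 - 1) / 4%:R :> K.
  have K4 : 4%:R != 0 :> K by apply: K_nat_neq0.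
  by rewrite b2; field.
have K4 : 4%:R != 0 :> K by apply: K_nat_neq0.
by field; rewrite K2 K4.
Qed.

Lemma omega_integer : omega \in Opred.
Proof.
rewrite unfold_in; apply/asboolP.
apply: (@integral_root_monic _ _ _ omega ('X^2 - 'X - (c%:~R)%:P)).
- rewrite monicE -addrA lead_coefDl ?lead_coefXn // size_polyXn -opprD size_polyN.
  by rewrite size_XaddC.
- by rewrite /root !hornerE omega_sqr; apply/eqP; ring.
move=> x /(nthP 0)[i _ <-]; rewrite coefB coefB coefXn coefX coefC.
apply: integral_sub; first by apply: integral_sub; apply: integral_nat.
by case: ifP => _; [apply: integral_id | apply: integral0].
Qed.

Lemma zomega_inj m n m' n' : zomega m n = zomega m' n' -> m = m' /\ n = n'.
Proof.
move=> E; have : iota ((m - m')%:~R + (n - n')%:~R / 2%:R) +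
    iota ((n - n')%:~R / 2%:R) * b = 0.
  transitivity (zomega m n - zomega m' n'); last by rewrite E subrr.
  rewrite !(rmorphB, rmorphD, rmorphM, fmorphV, rmorph_nat, rmorph_int).
  by rewrite /zomega /omega; field.
move=> /irr_b[+ /eqP]; rewrite mulf_eq0 invr_eq0 orbF intr_eq0 subr_eq0 => mn /eqP nn.
split=> //; move/eqP: mn.
by rewrite nn subrr mul0r addr0 intr_eq0 subr_eq0 => /eqP.
Qed.

Lemma zomegaM m n m' n' : zomega m n * zomega m' n' =
  zomega (m * m' + n * n' * c) (m * n' + n * m' + n * n').
Proof.
have -> : zomega m n * zomega m' n' = (m * m')%:~R + (m * n' + n * m')%:~R * omega
   + (n * n')%:~R * omega ^+ 2.
  by rewrite /zomega !(rmorphD, rmorphM) /=; ring.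
by rewrite omega_sqr /zomega !(rmorphD, rmorphM) /=; ring.
Qed.

(** The discriminant B of Z[w] is prime to N, so that Z[w] / (N) is reduced.
    Explicitly, with T = 2 m + n the trace of m + n w, the hypothesis gives N
    | T n and N | T^2 + B n^2, whence N | T^4, then N | T, N | n and N | m. *)
Lemma zomega_sqr_dvd (N : nat) m n x y : squarefree N -> coprime N B ->
  zomega m n ^+ 2 = N%:R * zomega x y -> (N%:Z %| m)%Z /\ (N%:Z %| n)%Z.
Proof.
move=> sqfN copNB; rewrite expr2 zomegaM.
have -> : N%:R * zomega x y = zomega (N%:Z * x) (N%:Z * y).
  by rewrite /zomega !rmorphM /=; ring.
move=> /zomega_inj[Ex Ey].
pose T := 2 * m + n.
have NTn : (N%:Z %| T * n)%Z.
  by apply/dvdzP; exists y; rewrite [RHS]mulrC -Ey /T; ring.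
have NTB : (N%:Z %| T ^+ 2 + B%:Z * n ^+ 2)%Z.
  apply/dvdzP; exists (4 * x + 2 * y).
  have -> : (4 * x + 2 * y) * N = 4 * (N%:Z * x) + 2 * (N%:Z * y) by ring.
  by rewrite -Ex -Ey B_eq /T; ring.
have NT : (N%:Z %| T)%Z.
  apply/sqfN/sqfN.
  have -> : (T ^+ 2) ^+ 2 = T ^+ 2 * (T ^+ 2 + B%:Z * n ^+ 2) - B%:Z * T * n * (T * n).
    by ring.
  by rewrite rpredB // dvdz_mull.
have Nn : (N%:Z %| n)%Z.
  apply/sqfN; rewrite -(@Gauss_dvdzr _ B%:Z) //.
  have -> : B%:Z * n ^+ 2 = (T ^+ 2 + B%:Z * n ^+ 2) - T * T by ring.
  by rewrite rpredB // dvdz_mull.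
split=> //; apply/sqfN.
have -> : m ^+ 2 = N%:Z * x - n * (n * c) by rewrite -Ex; ring.
by rewrite rpredB ?dvdz_mulr.
Qed.

(** The trace 2 u and the norm u^2 - B v^2 are integers, and so is 2 v because
    B is squarefree; the norm equation modulo 4 shows that 2 u and 2 v have
    the same parity. *)
Lemma quadratic_integers (u v : rat) : iota u + iota v * b \in Opred ->
  exists m n : int, iota u + iota v * b = zomega m n.
Proof.
have [tau [tau_a tau_b]] := conj_b.
have tau_iota z : tau (iota z) = iota z.
  exact: etrans (fmorph_eq_rat (tau \o iota) z) (esym (fmorph_eq_rat iota z)).
set y := _ + _ => yO.
have tau_y : tau y = iota u - iota v * b.
  by rewrite /y rmorphD rmorphM !tau_iota tau_b mulrN.
have tyO : tau y \in Opred by apply: integer_rmorph.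
have [T TE] : exists T : int, 2 * u = T%:~R.
  apply: iota_int; have -> : iota (2 * u) = y + tau y; last exact: rpredD.
  by rewrite tau_y /y rmorphM rmorph_nat; ring.
have [N NE] : exists N : int, u ^+ 2 - v ^+ 2 * B%:R = N%:~R.
  apply: iota_int; have -> : iota (u ^+ 2 - v ^+ 2 * B%:R) = y * tau y; last exact: rpredM.
  by rewrite tau_y /y !(rmorphB, rmorphXn, rmorphM, rmorph_nat) -b_sqrt; ring.
have [k kE] : exists k : int, 2 * v * B%:R = k%:~R.
  apply: iota_int; have -> : iota (2 * v * B%:R) = (y - tau y) * b.
    by rewrite tau_y /y !rmorphM !rmorph_nat -b_sqrt; ring.
  by rewrite rpredM ?b_integer // rpredB.
have [n nE] : exists n : int, 2 * v = n%:~R.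
  have /dvdzP[n kn] : (B%:Z %| k)%Z.
    apply/sqfB; apply/dvdzP; exists (T ^+ 2 - 4 * N).
    apply: (@intr_inj rat); rewrite !(rmorphXn, rmorphM, rmorphB) /= -kE -TE -NE.
    by rewrite -pmulrn; ring.
  exists n; apply: (mulIf (_ : B%:R != 0)); first by rewrite pnatr_eq0 -lt0n.
  by rewrite kE kn rmorphM /= -pmulrn.
have parity : T ^+ 2 - B%:Z * n ^+ 2 = 4 * N.
  apply: (@intr_inj rat); rewrite !(rmorphXn, rmorphM, rmorphB) /= -nE -TE -NE.
  by rewrite -pmulrn; ring.
have [m mE] : exists m : int, T = n + 2 * m.
  have two_mod (z : int) : z = 2 * (z %/ 2)%Z \/ z = 2 * (z %/ 2)%Z + 1 by lia.
  move: parity; rewrite B_eq.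
  case: (two_mod T) => ->; case: (two_mod n) => ->;
    move: (T %/ 2)%Z (n %/ 2)%Z => t k2 parity.
  - by exists (t - k2); ring.
  - by exfalso; lia.
  - by exfalso; lia.
  - by exists (t - k2); ring.
exists m, n; apply: (mulfI K2).
transitivity (iota (2 * u) + iota (2 * v) * b).
  by rewrite /y !rmorphM !rmorph_nat; ring.
rewrite TE nE !rmorph_int mE rmorphD rmorphM /= /zomega /omega.
by field.
Qed.

(** Write x = U + a V with U, V in Q(b), and sigma for the conjugation a |-> -
    a. Then 2 U = x + sigma x is in Z[w]. So are W = a (x - sigma x) = 2 A V
    and W^2 / A = (x - sigma x)^2; thus A divides W in Z[w], which means that
    2 V is in Z[w]. Finally (2 U)^2 - A (2 V)^2 = 4 x (sigma x) with A = 2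
    modulo 4 shows that 2 divides 2 U, then 2 V. *)
Lemma integral_basis x : x \in Opred -> exists x0 x1 x2 x3 : int,
  x = zomega x0 x1 + a * zomega x2 x3.
Proof.
move=> xO; have [sigma [sigma_b sigma_a]] := conj_a.
have sigma_iota z : sigma (iota z) = iota z.
  exact: etrans (fmorph_eq_rat (sigma \o iota) z) (esym (fmorph_eq_rat iota z)).
have [u0 [u1 [u2 [u3 xE]]]] := biquadratic_decomp x.
have sx : sigma x = (iota u0 + iota u1 * b) - a * (iota u2 + iota u3 * b).
  by rewrite xE !(rmorphD, rmorphM) !sigma_iota sigma_a sigma_b mulNr.
have sxO : sigma x \in Opred by apply: integer_rmorph.
have sigma_z m n : sigma (zomega m n) = zomega m n.
  rewrite /zomega /omega rmorphD rmorphM fmorph_div rmorphD rmorph1 sigma_b.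
  by rewrite !rmorph_int rmorph_nat.
have [P0 [P1 PE]] : exists m n, x + sigma x = zomega m n.
  have E : x + sigma x = iota (2 * u0) + iota (2 * u1) * b.
    by rewrite sx xE !rmorphM rmorph_nat; ring.
  by rewrite E; apply: quadratic_integers; rewrite -E rpredD.
have [W0 [W1 WE]] : exists m n, a * (x - sigma x) = zomega m n.
  have E : a * (x - sigma x) = iota (2 * u2 * A%:R) + iota (2 * u3 * A%:R) * b.
    by rewrite sx xE !rmorphM !rmorph_nat -a_sqrt; ring.
  rewrite E; apply: quadratic_integers; rewrite -E.
  by apply: rpredM; [exact: a_integer | exact: rpredB].
have A_neq0 := K_nat_neq0 A0.
have [Q0 [Q1 QE]] : exists m n, x - sigma x = a * zomega m n.
  have [v0 [v1 VE]] : exists m n, (x - sigma x) ^+ 2 = zomega m n.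
    have E : (x - sigma x) ^+ 2 =
        iota (4 * (u2 ^+ 2 + u3 ^+ 2 * B%:R) * A%:R) + iota (8 * u2 * u3 * A%:R) * b.
      rewrite sx xE !(rmorphD, rmorphXn, rmorphM, rmorph_nat) -a_sqrt -b_sqrt; ring.
    by rewrite E; apply: quadratic_integers; rewrite -E rpredX // rpredB.
  have [/dvdzP[m mE] /dvdzP[n nE]] : (A%:Z %| W0)%Z /\ (A%:Z %| W1)%Z.
    apply: zomega_sqr_dvd (v0) (v1) sqfA coprime_AB _.
    by rewrite -WE -VE -a_sqrt; ring.
  exists m, n; apply: (mulfI A_neq0).
  rewrite -[in LHS]a_sqrt -[a ^+ 2]/(a * a) -mulrA WE mE nE /zomega !rmorphM /= -pmulrn.
  ring.
have [N0 [N1 NE]] : exists m n, x * sigma x = zomega m n.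
  have E : x * sigma x = iota (u0 ^+ 2 + u1 ^+ 2 * B%:R - A%:R * (u2 ^+ 2 + u3 ^+ 2 * B%:R))
     + iota (2 * u0 * u1 - A%:R * (2 * u2 * u3)) * b.
    rewrite sx xE !(rmorphB, rmorphD, rmorphXn, rmorphM, rmorph_nat) -a_sqrt -b_sqrt; ring.
  by rewrite E; apply: quadratic_integers; rewrite -E rpredM.
have sqf2 : squarefree 2.
  by move=> z; rewrite !dvdzE abszX Euclid_dvdX // => /andP[].
have AE : A = (2 * (A %/ 2))%N by lia.
have cop2B : coprime 2 B by rewrite coprime2n; lia.
have A2odd : odd (A %/ 2) by lia.
have normE : zomega P0 P1 ^+ 2 - A%:R * zomega Q0 Q1 ^+ 2 = 4%:R * zomega N0 N1.
  by rewrite -PE -NE -a_sqrt -exprMn -QE; ring.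
have [/dvdzP[p0 P0E] /dvdzP[p1 P1E]] : (2%:Z %| P0)%Z /\ (2%:Z %| P1)%Z.
  pose X := (A %/ 2)%N%:Z.
  apply: (@zomega_sqr_dvd 2 _ _ (X * (Q0 * Q0 + Q1 * Q1 * c) + 2 * N0)
     (X * (Q0 * Q1 + Q1 * Q0 + Q1 * Q1) + 2 * N1)) => //.
  have -> : zomega P0 P1 ^+ 2 = A%:R * (zomega Q0 Q1 * zomega Q0 Q1) + 4%:R * zomega N0 N1.
    by rewrite -normE; ring.
  rewrite zomegaM /zomega [in LHS]AE natrM !(rmorphM, rmorphD) /= /X -!pmulrn; ring.
have [/dvdzP[q0 Q0E] /dvdzP[q1 Q1E]] : (2%:Z %| Q0)%Z /\ (2%:Z %| Q1)%Z.
  pose t := (A %/ 2 %/ 2)%N%:Z.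
  apply: (@zomega_sqr_dvd 2 _ _ 
     (p0 * p0 + p1 * p1 * c - t * (Q0 * Q0 + Q1 * Q1 * c) - N0)
     (p0 * p1 + p1 * p0 + p1 * p1 - t * (Q0 * Q1 + Q1 * Q0 + Q1 * Q1) - N1)) => //.
  apply: (mulfI K2); have -> : 2%:R * zomega Q0 Q1 ^+ 2 =
    (zomega P0 P1 ^+ 2 - 4%:R * zomega N0 N1) - (A%:R - 2%:R) * (zomega Q0 Q1 * zomega Q0 Q1).
    by rewrite -normE; ring.
  have -> : A%:R - 2%:R = 4%:R * t%:~R :> K.
    rewrite /t -pmulrn -natrM -natrB; last by lia.
    by congr (_%:R); lia.
  have -> : zomega P0 P1 ^+ 2 = 4%:R * (zomega p0 p1 * zomega p0 p1).
    by rewrite P0E P1E /zomega !rmorphM /=; ring.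
  by rewrite !zomegaM /zomega !(rmorphB, rmorphD, rmorphM) /=; ring.
exists p0, p1, q0, q1; apply: (mulfI K2).
transitivity ((x + sigma x) + (x - sigma x)); first by ring.
by rewrite PE QE P0E P1E Q0E Q1E /zomega !rmorphM /=; ring.
Qed.

Local Notation O := (ring_of_integers K).
Let aO : O := IntegerOf (a_integer).
Let bO : O := IntegerOf (b_integer).
Let wO : O := IntegerOf (omega_integer).

Lemma ring_of_integers_natr (n : nat) : integer_val (n%:R : O) = n%:R.
Proof. exact: (rmorph_nat (\val : {rmorphism O -> K})). Qed.
Lemma ring_of_integers_intr (n : int) : integer_val (n%:~R : O) = n%:~R.
Proof. exact: (rmorph_int (\val : {rmorphism O -> K})). Qed.

Let aO_sqrt : aO ^+ 2 = A%:R.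
Proof. by apply: val_inj; rewrite /= ring_of_integers_natr -a_sqrt. Qed.
Let bO_sqrt : bO ^+ 2 = B%:R.
Proof. by apply: val_inj; rewrite /= ring_of_integers_natr -b_sqrt. Qed.
Let wO_double : 2%:R * wO = 1 + bO.
Proof.
by apply: val_inj; rewrite [LHS]rmorphM [RHS]rmorphD rmorph1 rmorph_nat /= /omega mulrC divfK //.
Qed.
Let wO_sqr : wO ^+ 2 = wO + (B %/ 4)%:R.
Proof.
by apply: val_inj; rewrite /= ring_of_integers_natr -omega_sqr.
Qed.

Lemma ring_of_integers_basis (x : O) : exists x0 x1 x2 x3 : int,
  x = x0%:~R + x1%:~R * wO + aO * (x2%:~R + x3%:~R * wO).
Proof.
have [x0 [x1 [x2 [x3 xE]]]] := integral_basis (integer_valP x).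
by exists x0, x1, x2, x3; apply: val_inj; rewrite /= !ring_of_integers_intr -xE.
Qed.

(** The Frobenius map is known on a and b by [frobenius_fixed_sqrt], and on w
    because 2 w = 1 + b when l is odd, and w^2 = w + c with c = B / 4 rounded
    down when l = 2. If a or b (or w, for l = 2) is not fixed, it serves as
    the element showing that all residue fields have degree 2. *)
Lemma ostrowski_principal (l : nat) (pi : O) : prime l ->
  (exists c, l%:R = pi * c) -> (exists c, pi ^+ 2 = l%:R * c) ->
  (forall x : O, integer_val x = a -> (l %| A)%N -> exists c, x = pi * c) ->
  (forall x : O, integer_val x = b -> (l %| B)%N -> exists c, x = pi * c) ->
  forall f, principal_ideal (ostrowski_ideal K l f).
Proof.
move=> lp pl lp2 /(_ aO erefl) lA /(_ bO erefl) lB f.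
have frob_all n : frobenius_fixed l pi n aO -> frobenius_fixed l pi n wO ->
    forall x, frobenius_fixed l pi n x.
  move=> fa fw x; have [x0 [x1 [x2 [x3 ->]]]] := ring_of_integers_basis x.
  have fz := frobenius_fixed_int lp pl n.
  have fD := frobenius_fixedD lp pl (n := n).
  have fM := @frobenius_fixedM _ l pi n.
  by apply: (fD); [apply: (fD) | apply: (fM) => //; apply: (fD)] => //; apply: (fM).
have not_in (m : set O) (k : nat) : maximal_ideal m -> m l%:R -> coprime l k -> ~ m (k%:R : O).
  move=> mm ml lk mk; have [idm m1] := maximal_ideal_proper mm.
  by apply: m1; apply: coprime_ideal1 lk ml mk.
have split1 : (frobenius_fixed l pi 1 aO) -> (frobenius_fixed l pi 1 wO) ->
    forall x, exists c, x ^+ l - x = pi * c.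
  by move=> fa fw x; have := frob_all _ fa fw x; rewrite /frobenius_fixed expn1.
suff [[fa2 fw2] split_inert] :
    (frobenius_fixed l pi 2 aO /\ frobenius_fixed l pi 2 wO) /\
    ((frobenius_fixed l pi 1 aO /\ frobenius_fixed l pi 1 wO) \/
     exists g : O, forall m, maximal_ideal m -> m l%:R -> ~ m (g ^+ l - g)).
  apply: prod_of_norm_principal lp pl lp2 (frob_all _ fa2 fw2) _ _.
  by case: split_inert => [[fa fw]|inert]; [left; apply: split1 | right].
have [lo|l_even] := boolP (odd l).
  have fw n : frobenius_fixed l pi n bO -> frobenius_fixed l pi n wO.
    (* (l + 1)/2 is an inverse of 2 modulo l. *)
    move=> fb; apply: (@frobenius_fixed_eqpi _ l pi n _ ((l.+1)./2%:R * (1 + bO))).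
      apply: (@eqpi_l _ _ _ pl _ _ (- wO)).
      have -> : ((l.+1)./2%:R * (1 + bO)) = (l.+1)%:R * wO.
        rewrite -wO_double mulrA -natrM muln2 halfK /=.
        by rewrite lo subn0.
      by rewrite -[l.+1]addn1 natrD; ring.
    apply: frobenius_fixedM; first exact: frobenius_fixed_nat.
    apply: frobenius_fixedD => //.
    exact: (frobenius_fixed_nat lp pl n 1).
  have [fa2 fa1] := frobenius_fixed_sqrt lp lo pl aO_sqrt lA.
  have [fb2 fb1] := frobenius_fixed_sqrt lp lo pl bO_sqrt lB.
  split; first by split=> //; apply: fw.
  case: fa1 => [fa1|inert]; last by right; exists aO.
  case: fb1 => [/fw fw1|inert]; last by right; exists bO.
  by left.
have {l_even} l2 : l = 2 by case: (even_prime lp) l_even => // ->.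
subst l.
(* As A is even, pi divides a. *)
have fa n : frobenius_fixed 2 pi n aO.
  have [d ad] : exists c, aO = pi * c by apply: lA; lia.
  exists (d * (aO ^+ (2 ^ n).-1 - 1)).
  by rewrite mulrA -ad mulrBr mulr1 -exprS prednK // expn_gt0.
have two_mul (k : nat) : ~~ odd k -> k%:R = 2%:R * (k./2)%:R :> O.
  by move=> ek; rewrite -natrM mul2n even_halfK.
(* w^4 = (w + c)^2 = w + c + 2 c w + c^2, and c + c^2 is even. *)
have fw2 : frobenius_fixed 2 pi 2 wO.
  have := wO_sqr; set k := (B %/ 4)%N => w2.
  apply: (@eqpi_l _ _ _ pl _ _ (k%:R * wO + ((k + k * k)./2)%:R)).
  rewrite -[(2 ^ 2)%N]/4%N (exprM _ 2 2) w2 mulrDr -two_mul; last first.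
    by rewrite oddD oddM andbb addbb.
  by rewrite sqrrD w2 natrD natrM; ring.
split=> //; have [oc|ec] := boolP (odd (B %/ 4)).
  right; exists wO => m mm ml; rewrite wO_sqr addrC addKr.
  by apply: not_in; rewrite ?coprime2n.
left; split=> //; apply: (@eqpi_l _ _ _ pl _ _ (B %/ 4)./2%:R).
by rewrite expn1 wO_sqr addrC addKr two_mul.
Qed.
End Biquadratic.

(** * Rational numbers generating squares of principal ideals *)

Section AmbiguousIntegers.
Variable K : fieldExtType rat.
Local Notation O := (ring_of_integers K).

(** The principal ideal (n) is the square of (x); e is the unit by which x ^+
    2 and n differ. *)
Definition sqrt_ideal_principal (n : nat) : Prop :=
  exists x e e' : O, e * e' = 1 /\ x ^+ 2 = n%:R * e.

(** The ring of integers is integrally closed in K. *)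
Lemma ring_of_integers_sqrt (z : K) (y : O) : z ^+ 2 = integer_val y ->
  exists x : O, integer_val x = z.
Proof.
move=> zy; have zO : z \in @integer_pred K.
  by apply: integral_sqrt; rewrite zy; apply: integer_valP.
by exists (IntegerOf zO).
Qed.

Lemma sqrt_ideal_principal_cancel m n : (0 < m)%N -> sqrt_ideal_principal m ->
  sqrt_ideal_principal (m * n) -> sqrt_ideal_principal n.
Proof.
move=> m0 [x [e [e' [ee xe]]]] [y [f [f' [ff yf]]]].
have mK : m%:R != 0 :> K by rewrite -(rmorph_nat (in_alg K)) fmorph_eq0 pnatr_eq0 -lt0n.
have E : (integer_val (x * y) / m%:R) ^+ 2 = integer_val (n%:R * (e * f)).
  apply: (mulfI (_ : m%:R ^+ 2 != 0)); first exact: expf_neq0.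
  rewrite expr_div_n mulrC divfK ?expf_neq0 //.
  have -> : integer_val (x * y) ^+ 2 = integer_val ((x * y) ^+ 2) by [].
  rewrite -ring_of_integers_natr; apply: (congr1 (@integer_val K) (_ : _ = m%:R ^+ 2 * _)).
  by rewrite exprMn xe yf natrM; ring.
have [z zE] := ring_of_integers_sqrt E.
exists z, (e * f), (e' * f'); split; first by rewrite mulrACA ee ff mulr1.
by apply: val_inj; apply: etrans E; rewrite -zE.
Qed.

Lemma sqrt_ideal_principal_sqrt (n : nat) (z : K) : z ^+ 2 = n%:R -> sqrt_ideal_principal n.
Proof.
move=> zn; have [|x xz] := @ring_of_integers_sqrt z n%:R.
  by rewrite ring_of_integers_natr.
exists x, 1, 1; rewrite mulr1; split=> //; apply: val_inj.
by rewrite rmorphXn /= xz zn mulr1 ring_of_integers_natr.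
Qed.

(** The element x = d1 u + v z has square d1 (d1 u^2 + d2 v^2 + 2 u v z), and
    the second factor is a unit, of inverse d1 u^2 + d2 v^2 - 2 u v z. *)
Lemma sqrt_ideal_principal_pell (d1 d2 u v : nat) (z : K) :
  z ^+ 2 = (d1 * d2)%:R -> (d1 * u ^ 2 = d2 * v ^ 2 + 1)%N -> sqrt_ideal_principal d1.
Proof.
move=> zD E; have [|x xz] := @ring_of_integers_sqrt z (d1 * d2)%:R.
  by rewrite ring_of_integers_natr.
have xD : x ^+ 2 = d1%:R * d2%:R.
  by apply: val_inj; rewrite -natrM rmorphXn /= xz zD ring_of_integers_natr.
have {}E : d1%:R * u%:R ^+ 2 = d2%:R * v%:R ^+ 2 + 1 :> O.
  by rewrite -!natrX -!natrM E natrD.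
exists (d1%:R * u%:R + v%:R * x).
pose t : O := d1%:R * u%:R ^+ 2 + d2%:R * v%:R ^+ 2; pose w : O := 2%:R * u%:R * v%:R * x.
exists (t + w), (t - w); split.
  rewrite mulrC -subr_sqr /w /t exprMn xD.
  transitivity ((d1%:R * u%:R ^+ 2 - d2%:R * v%:R ^+ 2) ^+ 2 : O); first by ring.
  by rewrite E addrAC subrr add0r expr1n.
rewrite sqrrD exprMn [(v%:R * x) ^+ 2]exprMn xD /t /w; ring.
Qed.

(** If y ^+ 2 = l e and x ^+ 2 = l k, then x / y is integral, since its square
    k / e is. *)
Lemma sqrt_ideal_principal_uniformizer (l : nat) : (0 < l)%N -> sqrt_ideal_principal l ->
  exists pi : O, [/\ exists c, l%:R = pi * c, exists c, pi ^+ 2 = l%:R * c &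
    forall (N : nat) (x : O), x ^+ 2 = N%:R -> (l %| N)%N -> exists c, x = pi * c].
Proof.
move=> l0 [y [e [e' [ee ye]]]]; exists y; split; [|by exists e|].
  by exists (y * e'); rewrite mulrA -expr2 ye -mulrA ee mulr1.
move=> N x xN /dvdnP[k kl].
have lK : l%:R != 0 :> K by rewrite -(rmorph_nat (in_alg K)) fmorph_eq0 pnatr_eq0 -lt0n.
have yv : integer_val y ^+ 2 = l%:R * integer_val e.
  have /(congr1 \val) := ye; rewrite rmorphXn /= => ->.
  by rewrite ring_of_integers_natr.
have ev : integer_val e * integer_val e' = 1 by have /(congr1 \val) := ee.
have e0 : integer_val e != 0.
  by apply: contraTneq (oner_neq0 K) => e0; rewrite -ev e0 mul0r eqxx.
have y0 : integer_val y != 0.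
  by rewrite -sqrf_eq0 yv mulf_neq0.
have xv : integer_val x ^+ 2 = k%:R * l%:R.
  have /(congr1 \val) := xN; rewrite rmorphXn /= => ->.
  by rewrite ring_of_integers_natr kl natrM.
have [|c cE] := @ring_of_integers_sqrt (integer_val x / integer_val y) (k%:R * e').
  rewrite expr_div_n xv yv /= ring_of_integers_natr.
  apply: (mulIf (_ : l%:R * integer_val e != 0)); first exact: mulf_neq0.
  by rewrite divfK ?mulf_neq0 // -!mulrA (mulrC _ (l%:R * _)) -mulrA ev mulr1.
by exists c; apply: val_inj; rewrite /= cE mulrC divfK.
Qed.
End AmbiguousIntegers.

(** * The Polya property *)

(** The criterion [ostrowski_principal] is applied with pi = l if l is
    unramified, and with pi ^+ 2 equal to l times a unit if l is one of 2, p,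
    q, r, s. *)
Lemma polya_field_biquadratic (p q r s : nat) :
  prime p -> prime q -> prime r -> prime s ->
  (p %% 4 = 3)%N -> (q %% 4 = 3)%N -> (r %% 4 = 3)%N -> (s %% 4 = 1)%N ->
  p != q -> p != r -> q != r ->
  (symbols_i (nonresidue 2 p) (nonresidue 2 q) (nonresidue 2 r)
     (nonresidue 2 s) (nonresidue p q) (nonresidue p r)
     (nonresidue s p) (nonresidue s q) (nonresidue s r)) ||
  (symbols_ii (nonresidue 2 p) (nonresidue 2 q) (nonresidue 2 r)
    (nonresidue 2 s) (nonresidue p q) (nonresidue p r) (nonresidue q r)
    (nonresidue s p) (nonresidue s q) (nonresidue s r)) ->
  forall (K : fieldExtType rat) (a b : K),
  a ^+ 2 = (2 * p)%:R -> b ^+ 2 = (q * r * s)%:R ->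
  <<1 & [:: a; b]>>%VS = {:K}%VS -> polya_field K.
Proof.
move=> pp qp rp sp p4 q4 r4 s4 pq pr qr cases K a b a2 b2 K_gen.
have [sNp sNq sNr] : [/\ s != p, s != q & s != r].
  by split; apply/eqP => E; move: s4; rewrite E ?p4 ?q4 ?r4.
have [N2p N2q N2r N2s] : [/\ 2 != p, 2 != q, 2 != r & 2 != s]%N by split; lia.
have u5 : uniq [:: 2; p; q; r; s]%N.
  by rewrite /= !inE !negb_or N2p N2q N2r N2s pq pr qr !(eq_sym _ s) sNp sNq sNr.
have prime5 : all prime [:: 2; p; q; r; s]%N by rewrite /= pp qp rp sp.
have AE : (2 * p = \prod_(l <- [:: 2; p]) l)%N by rewrite !(big_cons, big_nil) muln1.
have BE : (q * r * s = \prod_(l <- [:: q; r; s]) l)%N.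
  by rewrite !(big_cons, big_nil) muln1 mulnA.
have ABE : (2 * p * (q * r * s) = \prod_(l <- [:: 2; p; q; r; s]) l)%N.
  by rewrite !(big_cons, big_nil) muln1 !mulnA.
have sqfA : squarefree (2 * p).
  rewrite AE; apply: squarefree_prod; last by rewrite /= pp.
  exact: (subseq_uniq (prefix_subseq [:: 2; p]%N [:: q; r; s]) u5).
have sqfB : squarefree (q * r * s).
  rewrite BE; apply: squarefree_prod; last by rewrite /= qp rp sp.
  exact: (subseq_uniq (suffix_subseq [:: 2; p]%N [:: q; r; s]) u5).
have sqfAB : squarefree (2 * p * (q * r * s)) by rewrite ABE; apply: squarefree_prod.
have p1 := prime_gt1 pp; have q1 := prime_gt1 qp.
have r1 := prime_gt1 rp; have s1 := prime_gt1 sp.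
have B1 : (1 < q * r * s)%N.
  by rewrite (leq_trans s1) // leq_pmull // muln_gt0 !prime_gt0.
have B4 : (q * r * s %% 4 = 1)%N by rewrite -modnMm -(modnMm q) q4 r4 s4.
have A4 : (2 * p %% 4 = 2)%N by lia.
have A1 : (1 < 2 * p)%N by lia.
have AB1 : (1 < 2 * p * (q * r * s))%N by rewrite (leq_trans A1) // leq_pmulr // ltnW.
have copAB : coprime (2 * p) (q * r * s).
  by rewrite !(coprimeMl, coprimeMr, prime_coprime) // !dvdn_prime2 // N2q N2r N2s pq pr eq_sym sNp.
have ab2 : (a * b) ^+ 2 = (2 * p * (q * r * s))%:R by rewrite exprMn a2 b2 -natrM.
have [R2 Rp Rq Rr Rs] : [/\ sqrt_ideal_principal K 2, sqrt_ideal_principal K p,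
    sqrt_ideal_principal K q, sqrt_ideal_principal K r & sqrt_ideal_principal K s].
  apply: ambiguous_generators cases => //.
  - exact: sqrt_ideal_principal_cancel.
  - move=> d1 d2 u v [d12|[d12|d12]] E; apply: sqrt_ideal_principal_pell E; rewrite d12.
    + exact: a2.
    + exact: b2.
    + exact: ab2.
  - exact: sqrt_ideal_principal_sqrt a2.
  - exact: sqrt_ideal_principal_sqrt b2.
move=> l f lp _.
have principal_l := ostrowski_principal a2 b2 K_gen sqfA sqfB A4 B4 copAB
  (squarefree_nonsquare sqfA A1) (squarefree_nonsquare sqfB B1)
  (squarefree_nonsquare sqfAB AB1) lp.
have [l_ram|l_unram] := boolP (l \in [:: 2; p; q; r; s]%N).
  have Rl : sqrt_ideal_principal K l.
    by move: l_ram; rewrite !inE => /or4P[|||/orP[]] /eqP->.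
  have [pi [pi_l pi2 pi_sqrt]] := sqrt_ideal_principal_uniformizer (prime_gt0 lp) Rl.
  apply: principal_l pi_l pi2 _ _ f => x xE; apply: pi_sqrt.
    by apply: val_inj; rewrite rmorphXn /= xE a2 ring_of_integers_natr.
  by apply: val_inj; rewrite rmorphXn /= xE b2 ring_of_integers_natr.
have lAB : ~~ (l %| 2 * p * (q * r * s))%N by rewrite ABE dvd_prime_prod.
apply: (principal_l l%:R) f.
- by exists 1; rewrite mulr1.
- by exists l%:R; rewrite expr2.
- by move=> x _ lA; case/negP: lAB; apply: dvdn_mulr.
- by move=> x _ lB; case/negP: lAB; apply: dvdn_mull.
Qed.

Lemma legendre_neq (x y : nat) : legendre x y = -1 -> x != y.
Proof. by move=> xy; apply: contra_eqN xy => /eqP->; rewrite /legendre dvdzz. Qed.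

Lemma nonresidue_natM1 (m n l : nat) : prime l -> odd l ->
  legendre (m * n)%N l = 1 -> nonresidue m l (+) nonresidue n l = false.
Proof.
by rewrite PoszM => lp lo mn; rewrite -nonresidueM ?mn // nonresidue1.
Qed.

Lemma nonresidue_natMN1 (m n l : nat) : prime l -> odd l ->
  legendre (m * n)%N l = -1 -> nonresidue m l (+) nonresidue n l = true.
Proof.
by rewrite PoszM => lp lo mn; rewrite -nonresidueM ?mn // nonresidueN1.
Qed.

Lemma legendre_mul_neq (q r p : nat) : prime p -> odd p ->
  legendre (q * r)%N p = -1 -> [/\ p != q, p != r & q != r].
Proof.
move=> pp po qr; have := qr; rewrite PoszM legendreM // => qr'; split.
- by apply: contra_eqN qr' => /eqP->; rewrite {1}/legendre dvdzz mul0r.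
- by apply: contra_eqN qr' => /eqP->; rewrite {2}/legendre dvdzz mulr0.
- apply: contra_eqN qr' => /eqP->.
  by have := legendre_val p r; rewrite !inE => /or3P[] /eqP->.
Qed.

Lemma nonresidue2_eq_mod8 (p q : nat) : prime p -> prime q ->
  (p %% 4 = 3)%N -> (q %% 4 = 3)%N ->
  (nonresidue 2 p == nonresidue 2 q) = (p == q %[mod 8]).
Proof. by move=> pp qp p4 q4; rewrite !nonresidue2_mod4_3 //; lia. Qed.

Lemma nonresidue2_neq (p q : nat) : prime p -> odd p -> prime q -> odd q ->
  legendre 2 p <> legendre 2 q -> nonresidue 2 p != nonresidue 2 q.
Proof.
move=> pp po qp qo; apply: contra_not_neq => pq.
have ndvd l : prime l -> odd l -> ~~ (l%:Z %| 2)%Z.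
  by move=> lp lo; rewrite dvdzE /= dvdn_prime2 //; apply: contraTneq lo => ->.
by rewrite !legendre_sign ?ndvd // pq.
Qed.

Theorem theorem4 (p q r s : nat)
  (p_prime : prime p) (q_prime : prime q) (r_prime : prime r)
  (s_prime : prime s)
  (p_mod4 : (p = 3 %[mod 4])%N) (q_mod4 : (q = 3 %[mod 4])%N)
  (r_mod4 : (r = 3 %[mod 4])%N) (qrs_mod4 : (q * r * s = 1 %[mod 4])%N)
  (not_both : ~ (legendre q s = 1 /\ legendre r s = 1))
  (K : fieldExtType rat) (a b : K)
  (a_sqrt : a ^+ 2 = (2 * p)%:R) (b_sqrt : b ^+ 2 = (q * r * s)%:R)
  (K_gen : <<1 & [:: a; b]>>%VS = {:K}%VS) :
  (* (i) *)
  ([/\ legendre q s = -1, legendre r s = -1 &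
    [\/ (* C1 *)
        [/\ legendre (2 * p)%N s = -1, legendre (q * r)%N p = -1,
            legendre (2 * p)%N q = 1 & (q <> r %[mod 8])%N],
        (* C2 *)
        [/\ legendre s p = 1, legendre (q * r)%N p = -1,
            (p = q %[mod 8])%N, (q = r %[mod 8])%N & (s = 5 %[mod 8])%N]
      | (* C3 *)
        [/\ legendre s p = -1 /\ legendre (q * r)%N p = -1,
            (p <> q %[mod 8])%N, (q = r %[mod 8])%N & (s = 1 %[mod 8])%N]]]
  \/
  (* (ii) *)
  [/\ legendre q s = -1, legendre r s = 1 &
    [\/ (* C4 *)
        [/\ legendre r p = -1, legendre p q = -1, legendre q r = -1 &
            [/\ legendre 2 p = -1, legendre 2 r = -1, legendre 2 s = -1
              & legendre s p = 1]
            \/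
            [/\ legendre 2 p = 1, legendre 2 q = 1, - legendre 2 r = 1,
                legendre 2 s = 1 & legendre s p = -1]],
        (* C5 *)
        [/\ legendre r p = -1, legendre p q = -1, legendre r q = -1 &
            [/\ legendre 2 p = 1, - legendre 2 r = 1, - legendre 2 s = 1
              & legendre s p = 1]
            \/
            [/\ legendre 2 p <> legendre 2 q, legendre 2 r = -1,
                legendre 2 s = 1 & legendre s p = -1]],
        (* C6 *)
        [/\ legendre p r = -1, legendre q p = -1, legendre r q = -1 &
            [/\ legendre 2 p = 1, legendre 2 r = 1, - legendre 2 s = 1
              & legendre s p = 1]
            \/
            [/\ legendre 2 p = -1, legendre 2 q = -1, - legendre 2 r = -1,
                - legendre 2 s = -1 & legendre s p = -1]]
      | (* C7 *)
        [/\ legendre p r = -1, legendre q p = -1, legendre q r = -1 &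
            [/\ legendre 2 p = -1, - legendre 2 r = -1, legendre 2 s = -1
              & legendre s p = 1]
            \/
            [/\ legendre 2 p <> legendre 2 q, legendre 2 r = 1,
                legendre 2 s = 1 & legendre s p = -1]]]]) ->
  polya_field K.
Proof.
move=> cases.
have p4 : (p %% 4 = 3)%N := p_mod4.
have q4 : (q %% 4 = 3)%N := q_mod4.
have r4 : (r %% 4 = 3)%N := r_mod4.
have s4 : (s %% 4 = 1)%N.
  by move: qrs_mod4; rewrite -modnMm -(modnMm q) q4 r4 mul1n modn_mod.
have [po qo ro so] := And4 (odd_mod4_3 p4) (odd_mod4_3 q4) (odd_mod4_3 r4) (odd_mod4_1 s4).
have [pNq pNr qNr] : [/\ p != q, p != r & q != r].
  case: cases => [[_ _ cases]|[qs rs cases]].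
    by apply: legendre_mul_neq => //; case: cases => [[]|[]|[[]]].
  have qNr : q != r by apply: contra_eqN qs => /eqP->; rewrite rs.
  case: cases => [[rp pq _ _]|[rp pq _ _]|[pr qp _ _]|[pr qp _ _]]; split=> //;
    by [apply: legendre_neq | rewrite eq_sym; apply: legendre_neq].
have [sNp sNq sNr] : [/\ s != p, s != q & s != r].
  by split; apply/eqP => E; move: s4; rewrite E ?p4 ?q4 ?r4.
apply: polya_field_biquadratic a_sqrt b_sqrt K_gen => //.
have qp := reciprocity_mod4_3 p_prime q_prime pNq p4 q4.
have rp := reciprocity_mod4_3 p_prime r_prime pNr p4 r4.
have rq := reciprocity_mod4_3 q_prime r_prime qNr q4 r4.
have ps := reciprocity_mod4_1 s_prime p_prime sNp s4 po.
have qs := reciprocity_mod4_1 s_prime q_prime sNq s4 qo.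
have rs := reciprocity_mod4_1 s_prime r_prime sNr s4 ro.
have opp (x y : int) : - x = y -> x = - y by move=> <-; rewrite opprK.
have opp1 (x : int) : - x = -1 -> x = 1 by move/opp; rewrite opprK.
have n1 := nonresidue1; have nN1 (x : int) y : legendre x y = -1 -> nonresidue x y = true.
  exact: nonresidueN1.
apply/orP; case: cases => [[/nN1 sq /nN1 sr C]|[/nN1 sq /n1 sr C]];
  rewrite qs in sq; rewrite rs in sr; [left|right].
  rewrite /symbols_i sq sr /=; case: C => [[]|[]|[[]]].
  - move=> /(nonresidue_natMN1 s_prime so) + /(nonresidue_natMN1 p_prime po)
      + /(nonresidue_natM1 q_prime qo) + /eqP.
    rewrite -nonresidue2_eq_mod8 // ps qp rp => -> -> -> ->.
    by [].
  - move=> /n1 -> /(nonresidue_natMN1 p_prime po) + /eqP + /eqP + s8.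
    by rewrite -!nonresidue2_eq_mod8 // qp rp (nonresidue2_mod4_1 s_prime s4) s8 => -> -> ->; rewrite !orbT.
  - move=> /nN1 -> /(nonresidue_natMN1 p_prime po) + /eqP + /eqP + s8.
    by rewrite -!nonresidue2_eq_mod8 // qp rp (nonresidue2_mod4_1 s_prime s4) s8 => -> -> ->; rewrite !orbT.
have neq2 := nonresidue2_neq p_prime po q_prime qo.
rewrite /symbols_ii sq sr /=; case: C => [[]|[]|[]|[]].
- by move=> /nN1 + /nN1 + /nN1 +
    [[/nN1 + /nN1 + /nN1 + /n1]|[/n1 + /n1 + /opp/nN1 + /n1 + /nN1]];
  rewrite rp => /negbTE ->; do !move=> ->; rewrite ?orbT.
- by move=> /nN1 + /nN1 + /nN1 +
    [[/n1 + /opp/nN1 + /opp/nN1 + /n1]|[/neq2 + /nN1 + /n1 + /nN1]];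
  rewrite rp rq => /negbTE -> -> /negbTE ->; do !move=> ->; rewrite ?orbT.
- by move=> /nN1 + /nN1 + /nN1 +
    [[/n1 + /n1 + /opp/nN1 + /n1]|[/nN1 + /nN1 + /opp1/n1 + /opp1/n1 + /nN1]];
  rewrite qp rq => -> /negbTE -> /negbTE ->; do !move=> ->; rewrite ?orbT.
- by move=> /nN1 + /nN1 + /nN1 +
    [[/nN1 + /opp1/n1 + /nN1 + /n1]|[/neq2 + /n1 + /n1 + /nN1]];
  rewrite qp => -> /negbTE -> ->; do !move=> ->; rewrite ?orbT.
Qed.
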